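(* Let $N$ be a non-negative, integer-valued random variable with $0<\mathbb{E}[N]$ and $\mathbb{E}[N^3]<\infty$. Let $X_1,X_2,\ldots$ be exchangeable real-valued random variables, independent of $N$, with $\mathbb{E}[X_1]=0$, $\mathrm{Var}(X_1)>0$ and $\mathbb{E}|X_1|^3<\infty$, which satisfy the equally correlated model with parameter $\rho\in[0,1]$ (see context). Let $Y=X_1+\cdots+X_N$, $\widetilde{Y}=Y/\sqrt{\mathrm{Var}(Y)}$ and $\widetilde{Z}\sim\mathrm{N}(0,1)$. Let $$\tau=\frac{\rho\,\mathbb{E}[N^2]}{\mathbb{E}[N]+\rho\,\mathbb{E}[N(N-1)]},\qquad \mathrm{Var}(Y)=\mathrm{Var}(X_1)\left\{\mathbb{E}[N]+\rho\,\mathbb{E}[N(N-1)]\right\}.$$ Then $$d_W(\widetilde{Y},\widetilde{Z})\leq 2\tau\left(1+\frac{\mathbb{E}[N^3]\,\mathbb{E}|X_1|^3}{2\,\mathbb{E}[N^2]\,\mathrm{Var}(X_1)\sqrt{\mathrm{Var}(Y)}}\right)+\frac{2(1-\tau)}{\sqrt{\mathrm{Var}(Y)}}\left(\frac{\mathbb{E}|X_1|^3}{2\,\mathrm{Var}(X_1)}+\mathbb{E}\left|\sum_{j=1}^{N^s-1}X_j'-\sum_{k=1}^N X_k\right|\right)$$ for any coupling of $N^s$ and $N$, where $N^s$ is the size-biased version of $N$, the $X_j'$ ($j\ge 1$) are IID copies of $X_1$ defined on the same probability space as the $X_k$, and the pair $(N,N^s)$ is independent of $\big((X_k)_{k\g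e1},(X'_j)_{j\ge1}\big)$.
   Context: Equally correlated model with parameter $\rho\in[0,1]$: for all $n\in\{1,2,\ldots\}$ and all real $t_1,\ldots,t_n$, $$\mathbb{E}[e^{i(t_1X_1+\cdots+t_nX_n)}]=\rho\,\mathbb{E}[e^{iX_1(t_1+\cdots+t_n)}]+(1-\rho)\prod_{j=1}^n\mathbb{E}[e^{it_jX_j}].$$ Size-biased version: for a non-negative random variable $X$ with $\mathbb{E}[X]>0$, $X^s$ is a random variable whose law is determined by $\mathbb{E}g(X^s)=\mathbb{E}[Xg(X)]/\mathbb{E}[X]$ for all $g:\mathbb{R}^+\to\mathbb{R}$ for which this expectation exists. Wasserstein distance: $d_W(U,V)=\sup_{h\in\mathcal{H}_W}|\mathbb{E}h(U)-\mathbb{E}h(V)|$, where $\mathcal{H}_W$ is the set of absolutely continuous $h:\mathbb{R}\to\mathbb{R}$ with $\|h'\|\le1$ and $\|\cdot\|$ is the supremum norm. A coupling of two random variables is a construction of them on a common probability space with their given marginal laws. An empty sum is $0$. *)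

(* Defs.v *)
From HB Require Import structures.
From mathcomp Require Import all_boot all_order all_fingroup all_algebra.
From mathcomp Require Import complex.
From mathcomp Require Import all_classical all_reals all_analysis.
Set Implicit Arguments.
Unset Strict Implicit.
Unset Printing Implicit Defensive.
Import Order.TTheory GRing.Theory Num.Theory.
Import numFieldNormedType.Exports.
Local Open Scope classical_set_scope.
Local Open Scope ring_scope.
Local Open Scope complex_scope.

Section complex_expectation.
Context (R : realType) (d : measure_display) (T : measurableType d).
Variable P : probability T R.

Definition expi (x : R) : R[i] := cos x +i* sin x.

Definition cexpectation (Z : T -> R[i]) : R[i] :=
  fine ('E_P[fun w => complex.Re (Z w)])%E +i*
  fine ('E_P[fun w => complex.Im (Z w)])%E.

End complex_expectation.

(* Sequences [X_1, X_2, ...] are indexed from 0: [X k] stands for [X_(k+1)]. *)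
Section probability.
Context (R : realType) (d : measure_display) (T : measurableType d).
Variable P : probability T R.

Definition equally_correlated (X : nat -> T -> R) (rho : R) : Prop :=
  forall (n : nat) (t : 'I_n -> R), (0 < n)%N ->
    cexpectation P (fun w => expi (\sum_(j < n) t j * X j w)) =
    rho%:C * cexpectation P (fun w => expi (X 0%N w * \sum_(j < n) t j)) +
    (1 - rho)%:C * \prod_(j < n) cexpectation P (fun w => expi (t j * X j w)).

Definition exchangeable (X : nat -> T -> R) : Prop :=
  forall (n : nat) (s : {perm 'I_n}) (A : set (n.-tuple R)), measurable A ->
    P [set w | A [tuple X (s i) w | i < n]] = P [set w | A [tuple X i w | i < n]].

Definition sigma_family d' (S : measurableType d') (I : Type)
    (X : I -> T -> S) : set (set T) :=
  <<s \bigcup_(i in [set: I]) g_sigma_algebra_preimage (X i) >>.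

Definition independent_systems (F G : set (set T)) : Prop :=
  forall A B, F A -> G B -> P (A `&` B) = (P A * P B)%E.

Definition mutually_independent (X : nat -> T -> R) : Prop :=
  forall (J : seq nat) (B : nat -> set R), uniq J ->
    (forall j, measurable (B j)) ->
    P (\bigcap_(j in [set` J]) X j @^-1` B j) =
    (\prod_(j <- J) P (X j @^-1` B j))%E.

Definition iid_copies (X' : nat -> T -> R) (X0 : T -> R) : Prop :=
  mutually_independent X' /\
  forall j (B : set R), measurable B -> P (X' j @^-1` B) = P (X0 @^-1` B).

(* [V] has the size-biased law of [U], for [U] and [V] non-negative; only the
   values of [g] on [0, +oo[ matter. *)
Definition size_biased (U V : T -> R) : Prop :=
  forall g : R -> R, measurable_fun (`[0, +oo[%classic : set R) g ->
    P.-integrable setT (fun w => (U w * g (U w))%:E) ->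
    ('E_P[g \o V] = ('E_P[fun w => (U w * g (U w))%R] * ((fine 'E_P[U])^-1)%:E))%E.

Definition random_sum (N : T -> nat) (X : nat -> T -> R) (w : T) : R :=
  \sum_(k < N w) X k w.

End probability.

Section wasserstein.
Context (R : realType).

Definition absolutely_continuous_on (a b : R) (h : R -> R) : Prop :=
  forall e : R, 0 < e -> exists2 delta : R, 0 < delta &
    forall (n : nat) (u v : 'I_n -> R),
      (forall i, [/\ a <= u i, u i <= v i & v i <= b]) ->
      trivIset setT (fun i => `]u i, v i[%classic) ->
      \sum_(i < n) (v i - u i) < delta ->
      \sum_(i < n) `|h (v i) - h (u i)| < e.

Definition absolutely_continuous (h : R -> R) : Prop :=
  forall a b : R, absolutely_continuous_on a b h.

(* The derivative of an absolutely continuous function is only defined almost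
   everywhere, and its supremum norm is meant in this sense. *)
Definition wasserstein_test : set (R -> R) :=
  [set h | absolutely_continuous h /\
     {ae (@lebesgue_measure R), forall x : R,
        derivable h x 1 /\ `|derive1 h x| <= 1}].

(* [U] and [V] may live on different probability spaces. *)
Definition wasserstein (d1 d2 : measure_display) (T1 : measurableType d1)
    (T2 : measurableType d2) (P1 : probability T1 R) (P2 : probability T2 R)
    (U : T1 -> R) (V : T2 -> R) : \bar R :=
  ereal_sup [set `| 'E_P1[h \o U] - 'E_P2[h \o V] |%E | h in wasserstein_test].

End wasserstein.

(* Main.v *)
Require Import Defs.
From HB Require Import structures.
From mathcomp Require Import all_boot all_order all_fingroup all_algebra.
From mathcomp Require Import complex.
From mathcomp Require Import all_classical all_reals all_analysis.
From mathcomp Require Import measurable_realfun ring lra.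
Set Implicit Arguments.
Unset Strict Implicit.
Unset Printing Implicit Defensive.
Import Order.TTheory GRing.Theory Num.Theory.
Import numFieldNormedType.Exports.
Local Open Scope classical_set_scope.
Local Open Scope ring_scope.

(** The bound is an instance of Stein's method. For a 1-Lipschitz function h,
    let f solve f'(x) - x f(x) = h(x) - E h(Z) and let g = f'. With s the inverse
    of the standard deviation of Y and W = s Y, the quantity to be bounded is

      E h(W) - E h(Z) = E g(W) - s E [Y f(s Y)],

    and g is 2-Lipschitz ([stein_solution]). It remains to evaluate E [Y f(s Y)].

    The model is an identity between characteristic functions. Taken with equal
    arguments, it says that the law of X_1 + ... + X_n is the mixture, with
    weights rho and 1 - rho, of the law of n X_1 and of the law of a sum S'_n of n
    independent copies of X_1 ([equally_correlated_law], by the uniqueness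
    theorem [measure_eq_of_trig_integrals]). For these two laws Taylor's formula
    and the centring of X_1 give, with m2 and m3 the second and third absolute
    moments of X_1,

      E [n X_1 f(s n X_1)] = s m2 n^2 g(0)           up to s^2 m3 n^3,
      E [S'_n f(s S'_n)]   = s m2 n E g(s S'_(n-1))  up to s^2 m3 n

    ([stein_error_multiple], [stein_error_iid_sum]). The index N is independent
    of the summands, so n may be replaced by N, and then size biasing turns
    E [N e(N - 1)] into E[N] E e(N^s - 1). Multiplied by s, the main terms become
    tau g(0) + (1 - tau) E g(s S'_(N^s-1)), with weights of sum 1 because W has
    variance 1. As g is 2-Lipschitz, E g(W) differs from this by at most
    2 tau E|W| + 2 (1 - tau) s E|S'_(N^s-1) - Y|, where E|W| <= 1, and the Taylor
    errors contribute s^3 m3 (rho E[N^3] + (1 - rho) E[N]); this is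
    [stein_operator_bound], and the sum of these terms is the stated bound.

    Two facts of analysis support the argument. A test function for the distance
    is 1-Lipschitz although its derivative is controlled almost everywhere only
    ([wasserstein_test_lipschitz]); this uses absolute continuity through a
    covering argument. And g inherits the constant 2 from an inequality for
    nondecreasing test functions ([stein_monotone]), applied to id + h and
    id - h. *)

(** * Absolutely continuous test functions are Lipschitz *)

(** Continuous induction: a property that can be carried across a neighbourhood
    of every point of [a, b] reaches b, because the supremum of the points
    reached is itself reached and cannot be smaller than b. *)
Lemma real_induction (R : realType) (a b : R) (G : R -> Prop) : a <= b -> G a ->
  (forall c, a <= c <= b -> exists2 r : R, 0 < r &
     forall x y, a <= x -> x <= c -> c <= y -> y <= b -> c - x < r -> y - c < r ->
       G x -> G y) ->
  G b.
Proof.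
move=> ab Ga step; pose S := [set x | a <= x <= b /\ G x].
have Sa : S a by split; rewrite // lexx.
have supS : has_sup S by split; [exists a | exists b => x [/andP[]]].
have aS : a <= sup S by apply: ub_le_sup => //; exact: supS.2.
have Sb : sup S <= b by apply: ge_sup; [exists a | move=> x [/andP[]]].
have [|r r0 stepr] := step (sup S); first by rewrite aS.
have [x [/andP[ax xb] Gx] Sx] := sup_adherent r0 supS.
have xS : x <= sup S by apply: ub_le_sup; [exact: supS.2 | split; rewrite ?ax].
have Sxr : sup S - x < r by lra.
have [eqb|ltb] := eqVneq (sup S) b; first by apply: (stepr x b); rewrite ?eqb ?subrr -?eqb.
pose y := Num.min b (sup S + r / 2).
have Sy : sup S < y by rewrite lt_min lt_neqAle ltb Sb ltrDl divr_gt0.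
have yb : y <= b by rewrite ge_min lexx.
have ySr : y - sup S < r.
  by rewrite ltrBlDl gt_min; apply/orP; right; lra.
have Gy : G y by apply: (stepr x y) => //; exact: ltW.
have : y <= sup S.
  by apply: ub_le_sup; [exact: supS.2 | split; rewrite ?yb ?(le_trans aS (ltW Sy))].
by rewrite leNgt Sy.
Qed.

(** A derivative at the single point c controls the increments that start or
    end at c; the bounds on the two sides of c add up to a bound on the
    increment across c. *)
Lemma derivable_lipschitz_at (R : realType) (h : R -> R) (c k e : R) :
  derivable h c 1 -> `|derive1 h c| <= k -> 0 < e ->
  exists2 r : R, 0 < r & forall y, `|y - c| < r ->
    `|h y - h c| <= (k + e) * `|y - c|.
Proof.
move=> dh hk e0.
have : (fun t : R => t^-1 *: ((h \o shift c) (t *: (1 : R)) - h c)) @ 0^' --> derive1 h c.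
  by rewrite derive1E; exact: dh.
move=> /cvgrPdist_le/(_ e e0).
rewrite /prop_near1 /= => -[r /= r0 hr]; exists r => // y yr.
have [->|yc] := eqVneq y c; first by rewrite !subrr normr0 mulr0.
have yc0 : y - c != 0 by rewrite subr_eq0.
have := hr (y - c); rewrite /ball_/= sub0r normrN => /(_ yr yc0).
rewrite /GRing.scale/= mulr1 subrK => H.
have : `|(y - c)^-1 * (h y - h c)| <= k + e.
  rewrite -[X in `|X|](subrK (derive1 h c)) addrC (le_trans (ler_normD _ _))//.
  by rewrite lerD// distrC.
by rewrite normrM normfV ler_pdivrMl ?normr_gt0// mulrC.
Qed.

(** Invariant of the covering argument: h is followed from a to x by steps.
    The list s keeps those contained in the open set O, on which nothing is
    known about the derivative of h; the slope of the other steps is at most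
    1 + e. The half-open interval makes the measure of O additive from one step
    to the next. *)
Definition interval_chain (R : realType) (O : set R) (h : R -> R) (a e x : R) : Prop :=
  exists s : seq (R * R),
  [/\ all (fun p => [&& a <= p.1, p.1 <= p.2 & p.2 <= x]) s,
     pairwise (fun p q => p.2 <= q.1) s,
     ((\sum_(p <- s) (p.2 - p.1))%:E <= @lebesgue_measure R (O `&` `[a, x[))%E &
     `|h x - h a| <= (1 + e) * (x - a) + \sum_(p <- s) `|h p.2 - h p.1| ].

Lemma interval_chain_step (R : realType) (O : set R) (h : R -> R) (a e x y : R) :
  open O -> 0 < e -> a <= x -> x <= y ->
  `[x, y] `<=` O \/ `|h y - h x| <= (1 + e) * (y - x) ->
  interval_chain O h a e x -> interval_chain O h a e y.
Proof.
move=> oO e0 ax xy H [s [sax sp sm sh]].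
have mO z : measurable (O `&` `[a, z[) by apply: measurableI => //; exact: open_measurable.
have sax' : all (fun p => [&& a <= p.1, p.1 <= p.2 & p.2 <= y]) s.
  by apply: sub_all sax => p /and3P[-> -> /le_trans ->].
have tri : `|h y - h a| <= `|h y - h x| + `|h x - h a| by exact: ler_distD.
case: H => [xyO|hxy]; last first.
  exists s; split => //.
    apply: (le_trans sm); apply: le_measure; rewrite ?inE; [exact: mO|exact: mO|].
    by apply: setIS; apply: subset_itvl; rewrite bnd_simp.
  by apply: (le_trans tri); nra.
exists (rcons s (x, y)); split.
- by rewrite all_rcons /= ax xy lexx.
- rewrite pairwise_rcons sp andbT; apply: sub_all sax => p /and3P[_ _].
  by [].
- rewrite -cats1 big_cat big_seq1 /= EFinD.
  have -> : O `&` `[a, y[ = (O `&` `[a, x[) `|` `[x, y[.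
    rewrite (@itv_bndbnd_setU _ _ (BLeft a) (BLeft x) (BLeft y)) ?bnd_simp//.
    rewrite setIUr; congr (_ `|` _); apply/setIidPr => z /= zxy; apply: xyO.
    by move: zxy; rewrite /= !in_itv/= => /andP[-> /ltW].
  rewrite measureU; [|exact: mO|by []|]; last first.
    rewrite -subset0 => z /= [[_]]; rewrite !in_itv/= => /andP[_ zx] /andP[xz _].
    by move: zx; rewrite ltNge xz.
  apply: leeD => //; rewrite [leRHS](_ : _ = (y - x)%:E)//.
  rewrite -[LHS]/(lebesgue_measure _) lebesgue_measure_itv/= lte_fin.
  by case: ltgtP xy => // -> _; rewrite subrr.
- rewrite -cats1 big_cat big_seq1 /=; apply: (le_trans tri).
  have : 0 <= (1 + e) * (y - x) by apply: mulr_ge0; lra.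
  by nra.
Qed.

(** The exceptional null set is covered by an open set U of measure smaller
    than the delta of absolute continuity. Near a point outside U the slope of
    h is at most 1 + e, near a point of U a whole neighbourhood lies in U, so
    continuous induction joins a to b by steps of these two kinds. The steps
    inside U have total length below delta, hence contribute at most e. *)
Lemma ac_le_of_ae_derivative_le1 (R : realType) (h : R -> R) (a b : R) :
  a <= b -> absolutely_continuous_on a b h ->
  {ae (@lebesgue_measure R), forall x : R, derivable h x 1 /\ `|derive1 h x| <= 1} ->
  `|h b - h a| <= b - a.
Proof.
move=> ab ach [N [mN N0 Nh]].
suff H e : 0 < e -> `|h b - h a| <= (1 + e) * (b - a) + e.
  apply/ler_addgt0Pr => e e0.
  have c0 : 0 < e / (b - a + 1) by rewrite divr_gt0//; lra.
  apply: (le_trans (H _ c0)).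
  have -> : (1 + e / (b - a + 1)) * (b - a) + e / (b - a + 1) = (b - a) + e.
    by field; lra.
  by [].
move=> e0.
have [delta delta0 acd] := ach _ e0.
have delta20 : 0 < delta / 2 by lra.
have [U [oU NU mU]] := outer_measure_open_le N delta20.
have {}mU : (@lebesgue_measure R U <= (delta / 2)%:E)%E.
  by have outerN0 : ((wlength idfun)^* N)%mu = 0%E := N0; move: mU; rewrite outerN0 add0e.
have [s [sax sp sm sh]] : interval_chain U h a e b.
  apply: (real_induction ab).
    exists [::]; split; rewrite ?big_nil//=.
    by rewrite !subrr normr0 mulr0 addr0.
  move=> c /andP[ac cb]; have [Uc|nUc] := pselect (U c).
    have [r /= r0 rU] := oU c Uc; exists r => // x y ax xc cy yb cxr ycr.
    apply: interval_chain_step => //; [exact: le_trans cy|left].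
    move=> z /=; rewrite in_itv/= => /andP[xz zy]; apply: rU => /=.
    by rewrite ltr_norml; apply/andP; split; lra.
  have [dh hk] : derivable h c 1 /\ `|derive1 h c| <= 1.
    by apply: contrapT => nd; apply: nUc; apply: NU; apply: Nh.
  have [r r0 hr] := derivable_lipschitz_at dh hk e0.
  exists r => // x y ax xc cy yb cxr ycr.
  apply: interval_chain_step => //; [exact: le_trans cy|right].
  have h1 : `|h y - h c| <= (1 + e) * (y - c).
    by have := hr y; rewrite ger0_norm ?subr_ge0//; apply.
  have h2 : `|h c - h x| <= (1 + e) * (c - x).
    by have := hr x; rewrite distrC ger0_norm ?subr_ge0// distrC; apply.
  by apply: (le_trans (ler_distD (h c) _ _)); nra.
apply: (le_trans sh); rewrite lerD2l ltW//.
pose p i := nth (0, 0) s i.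
have pin (i : 'I_(size s)) : [&& a <= (p i).1, (p i).1 <= (p i).2 & (p i).2 <= b].
  by apply: (allP sax); apply: mem_nth.
rewrite (big_nth (0, 0)) big_mkord.
apply: (acd (size s) (fun i => (p i).1) (fun i => (p i).2)).
- by move=> i; have /and3P[] := pin i.
- have dis (i j : 'I_(size s)) : (i < j)%N ->
      `](p i).1, (p i).2[%classic `&` `](p j).1, (p j).2[%classic = set0.
    move=> ij; have pij := (pairwiseP (0, 0) sp) i j (ltn_ord i) (ltn_ord j) ij.
    rewrite -subset0 => z /= [] /=; rewrite !in_itv/= => /andP[_ zi] /andP[jz _].
    by move: (lt_le_trans zi pij); rewrite ltNge ltW.
  apply/trivIsetP => i j _ _ ij.
  case: (ltngtP i j) => [/dis//|/dis|/val_inj eij]; first by rewrite setIC.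
  by rewrite eij eqxx in ij.
- have : ((\sum_(p0 <- s) (p0.2 - p0.1))%:E <= (delta / 2)%:E)%E.
    apply: (le_trans sm); apply: le_trans mU; apply: le_measure; rewrite ?inE.
    + by apply: measurableI => //; exact: open_measurable.
    + exact: open_measurable.
    + exact: subIsetl.
  rewrite lee_fin (big_nth (0, 0)) big_mkord => /le_lt_trans; apply; lra.
Qed.

Lemma wasserstein_test_lipschitz (R : realType) (h : R -> R) :
  wasserstein_test h -> forall x y, `|h y - h x| <= `|y - x|.
Proof.
move=> [ach aeh] x y; wlog xy : x y / x <= y.
  move=> H; case: (leP x y) => [/H//|/ltW/H]; by rewrite distrC (distrC x).
rewrite (ger0_norm (_ : 0 <= y - x)) ?subr_ge0//.
exact: ac_le_of_ae_derivative_le1.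
Qed.

(** * Measures with a density and the standard normal density *)

Lemma Rintegral_dominated_cvg d (T : measurableType d) (R : realType)
    (mu : {measure set T -> \bar R}) (u : nat -> T -> R) (f g : T -> R) :
  (forall n, measurable_fun setT (u n)) -> measurable_fun setT f ->
  (forall x, u n x @[n --> \oo] --> f x) ->
  mu.-integrable setT (EFin \o g) -> (forall n x, `|u n x| <= g x) ->
  \int[mu]_x u n x @[n --> \oo] --> \int[mu]_x f x.
Proof.
move=> mu_ mf uf ig ug.
have H1 n : measurable_fun setT (EFin \o u n) by exact/measurable_EFinP.
have H2 : measurable_fun setT (EFin \o f) by exact/measurable_EFinP.
have H3 : {ae mu, forall x, setT x -> (EFin \o u n) x @[n --> \oo] --> (EFin \o f) x}.
  by apply: aeW => x _; apply: cvg_EFin; [exact: nearW | exact: uf].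
have H4 : {ae mu, forall x n, setT x -> (`|(EFin \o u n) x| <= (EFin \o g) x)%E}.
  by apply: aeW => x n _ /=; rewrite lee_fin.
have [intf _ L] := dominated_convergence measurableT H1 H2 H3 ig H4.
by apply: fine_cvg; rewrite fineK; [exact: L | exact: integrable_fin_num].
Qed.

Section density.
Context d (T : measurableType d) (R : realType).
Variables (mu nu : {measure set T -> \bar R}) (p : T -> R).
Hypotheses (mp : measurable_fun setT p) (p0 : forall x, 0 <= p x).
Hypothesis nuE : forall A, measurable A -> nu A = (\int[mu]_(x in A) (p x)%:E)%E.
Local Open Scope ereal_scope.
Import HBNNSimple.

Let mpE : measurable_fun setT (EFin \o p). Proof. exact/measurable_EFinP. Qed.

Lemma integral_density_nnsfun (f : {nnsfun T >-> R}) :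
  \int[nu]_x (f x)%:E = \int[mu]_x ((f x)%:E * (p x)%:E).
Proof.
under [LHS]eq_integral do rewrite fimfunE -fsumEFin//.
rewrite [LHS]ge0_integral_fsum//; last 2 first.
  - by move=> r; exact/measurable_EFinP/measurableT_comp.
  - by move=> n x _; rewrite EFinM nnfun_muleindic_ge0.
under [RHS]eq_integral.
  move=> x xD; rewrite fimfunE -fsumEFin// muleC ge0_mule_fsumr; last first.
    by move=> r; rewrite EFinM nnfun_muleindic_ge0.
  over.
rewrite [RHS]ge0_integral_fsum//; last 2 first.
  - by move=> r; apply: emeasurable_funM => //; apply/measurable_EFinP; exact: measurableT_comp.
  - by move=> n x _; apply: mule_ge0; rewrite ?lee_fin// -lee_fin EFinM nnfun_muleindic_ge0.
apply: eq_fsbigr => r _.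
have mr : measurable (f @^-1` [set r]) by [].
rewrite integralZl_indic_nnsfun// integral_indic// setIT nuE//.
rewrite integral_mkcond.
under [RHS]eq_integral do rewrite EFinM muleCA.
have [r0|r0] := leP 0%R r.
  rewrite ge0_integralZl ?lee_fin//.
  - congr (_ * _); apply: eq_integral => x _; rewrite patchE indicE.
    by case: ifP => xr; rewrite /= ?mule1 ?mule0.
  - by apply: emeasurable_funM => //; apply/measurable_EFinP; exact: measurable_indic.
  - by move=> x _; rewrite mule_ge0 ?lee_fin.
have -> : f @^-1` [set r] = set0.
  rewrite -subset0 => x /= fxr; have : (0 <= f x)%R by [].
  by rewrite fxr leNgt r0.
rewrite -integral_mkcond integral_set0 mule0 indic0 integral0_eq// => x _.
by rewrite /= !mule0.
Qed.

Lemma ge0_integral_density (f : T -> \bar R) :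
  measurable_fun setT f -> (forall x, 0 <= f x) ->
  \int[nu]_x f x = \int[mu]_x (f x * (p x)%:E).
Proof.
move=> mf f0.
pose f_ := nnsfun_approx measurableT mf.
transitivity (lim (\int[nu]_x (f_ n x)%:E @[n --> \oo])).
  rewrite -monotone_convergence//=.
  - apply: eq_integral => ? /[!inE] xD; apply/esym/cvg_lim => //=.
    exact: cvg_nnsfun_approx.
  - by move=> n; exact/measurable_EFinP/measurable_funTS.
  - by move=> n ? _; rewrite lee_fin.
  - by move=> ? _ ? ? mn; rewrite lee_fin; exact/lefP/nd_nnsfun_approx.
transitivity (lim (\int[mu]_x ((f_ n x)%:E * (p x)%:E) @[n --> \oo])).
  by apply: congr_lim; apply/funext => n; exact: integral_density_nnsfun.
rewrite -monotone_convergence//=.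
- apply: eq_integral => x _; apply/cvg_lim => //=.
  apply: cvgeZr => //; exact: cvg_nnsfun_approx.
- by move=> n; apply: emeasurable_funM => //; exact/measurable_EFinP/measurable_funTS.
- by move=> n x _; rewrite mule_ge0 ?lee_fin.
- move=> x _ m n mn; apply: lee_wpmul2r; rewrite ?lee_fin//.
  exact/lefP/nd_nnsfun_approx.
Qed.

Lemma integral_density (f : T -> R) : measurable_fun setT f ->
  mu.-integrable setT (fun x => (f x * p x)%:E) ->
  nu.-integrable setT (EFin \o f) /\
  \int[nu]_x (f x)%:E = \int[mu]_x (f x * p x)%:E.
Proof.
move=> mf /integrableP[mfp intfp].
have mfE : measurable_fun setT (EFin \o f) by exact/measurable_EFinP.
have abs : \int[nu]_x `|(f x)%:E| < +oo.
  rewrite ge0_integral_density//; last exact: measurableT_comp.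
  apply: le_lt_trans intfp; rewrite le_eqVlt; apply/orP; left; apply/eqP.
  by apply: eq_integral => x _; rewrite -!EFinM /= normrM (ger0_norm (p0 x)).
split; first by apply/integrableP.
rewrite integralE [RHS]integralE; congr (_ - _).
- rewrite ge0_integral_density//; last exact: measurable_funepos.
  apply: eq_integral => x _; rewrite !funeposE /= -!EFin_max -EFinM.
  by rewrite maxr_pMl// mul0r.
- rewrite ge0_integral_density//; last exact: measurable_funeneg.
  apply: eq_integral => x _; rewrite !funenegE /= -!EFin_max -EFinM.
  by rewrite maxr_pMl// mul0r mulNr.
Qed.
End density.

Section normal_density.
Variable R : realType.
Notation mu := (@lebesgue_measure R).
Notation phi := (normal_pdf (0 : R) 1).

Lemma normal_pdf01E x : phi x = normal_peak 1 * expR (- x ^+ 2 / 2).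
Proof. by rewrite normal_pdfE ?oner_neq0// /normal_fun subr0 expr1n. Qed.

Lemma normal_pdf01_gt0 x : 0 < phi x.
Proof. by rewrite normal_pdf01E mulr_gt0 ?expR_gt0// normal_peak_gt0 ?oner_neq0. Qed.

Lemma is_derive_normal_pdf01 (x : R) : is_derive x (1 : R) phi (- (x * phi x)).
Proof.
have -> : phi = (fun x => normal_peak 1 * expR (- x ^+ 2 / 2)).
  by apply/funext => y; exact: normal_pdf01E.
rewrite [X in is_derive _ _ X _](_ : _ =
  (cst (normal_peak 1) * (expR \o (fun x : R => - x ^+ 2 / 2)))%R)//.
have D : is_derive x (1 : R) (fun x : R => - x ^+ 2 / 2) (- x).
  rewrite [X in is_derive _ _ X _](_ : _ = ((- (id ^+ 2)) * cst 2^-1)%R)//.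
  by apply: is_derive_eq; rewrite /GRing.scale/= mulr0; field.
by apply: is_derive_eq; rewrite /GRing.scale/= mulr0 addr0 !mulrN (mulrC _ x) mulrCA.
Qed.

(** The bound |x| <= 1 + x^2 / 4 <= exp (x^2 / 4) dominates |x| times the
    standard density by a multiple of the normal density of variance 2. *)
Lemma integrable_id_normal_pdf : mu.-integrable setT (fun x => (x * phi x)%:E).
Proof.
pose s2 : R := Num.sqrt 2.
have s20 : s2 != 0 by rewrite gt_eqF// sqrtr_gt0.
have peak0 := normal_peak_gt0 s20.
(* C converts the peak of the density of variance 2 into the standard one. *)
pose C := normal_peak 1 / normal_peak s2.
have intC : mu.-integrable setT (fun x => C%:E * (normal_pdf 0 s2 x)%:E)%E.
  by apply: integrableZl => //; exact: integrable_normal_pdf.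
apply: le_integrable intC => //.
  by apply/measurable_EFinP; apply: measurable_funM => //; exact: measurable_normal_pdf.
move=> x _ /=; rewrite lee_fin normal_pdf01E normal_pdfE// /normal_fun subr0.
have -> : s2 ^+ 2 *+ 2 = 4 by rewrite sqr_sqrtr// -mulr_natr -natrM.
have -> : C * (normal_peak s2 * expR (- x ^+ 2 / 4)) = normal_peak 1 * expR (- x ^+ 2 / 4).
  by rewrite /C mulrA divfK// gt_eqF.
rewrite !normrM !(ger0_norm (expR_ge0 _)) mulrCA ler_wpM2l//.
have -> : - x ^+ 2 / 2 = - x ^+ 2 / 4 + (- x ^+ 2 / 4) by field.
rewrite expRD mulrA -[leRHS]mul1r ler_wpM2r ?expR_ge0//.
have -> : - x ^+ 2 / 4 = - (x ^+ 2 / 4) by rewrite mulNr.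
rewrite expRN ler_pdivrMr ?expR_gt0// mul1r.
apply: le_trans (expR_ge1Dx _).
rewrite -[x ^+ 2]real_normK ?num_real//; have := sqr_ge0 (`|x| / 2 - 1).
by rewrite sqrrB1 exprMn; lra.
Qed.

Lemma integrable_cumulative_cvg (psi : R -> R) : mu.-integrable setT (EFin \o psi) ->
  (\int[mu]_(x in `]-oo, (n%:R : R)]) psi x @[n --> \oo] --> \int[mu]_x psi x) /\
  (\int[mu]_(x in `]-oo, (- n%:R : R)]) psi x @[n --> \oo] --> 0).
Proof.
move=> ipsi.
have mpsi : measurable_fun setT psi by apply/measurable_EFinP; exact: measurable_int ipsi.
have H (u : nat -> R) (g : R -> R) : measurable_fun setT g ->
   (forall x, (psi \_ `]-oo, u n]) x @[n --> \oo] --> g x) ->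
   (\int[mu]_(x in `]-oo, u n]) psi x @[n --> \oo] --> \int[mu]_x g x).
  move=> mg cvu.
  under eq_fun do rewrite Rintegral_mkcond.
  apply: (@Rintegral_dominated_cvg _ _ _ mu (fun n => psi \_ `]-oo, u n]) g
      (fun x => `|psi x|)) => //.
  - by move=> n; apply/(measurable_restrictT _ _).1 => //; exact: measurable_funTS.
  - exact: (integrable_norm ipsi).
  - by move=> n x; rewrite patchE; case: ifP; rewrite ?normr0.
split; first apply: H => //.
- move=> x; apply: cvg_near_cst; near=> n.
  rewrite patchE mem_set//= in_itv/=.
  by near: n; exact: nbhs_infty_ger.
- rewrite (_ : 0 = \int[mu]_x (cst 0 x)); last first.
    by rewrite Rintegral_cst// mul0r.
  apply: H => // x; apply: cvg_near_cst; near=> n.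
  rewrite patchE memNset//= in_itv/=; apply/negP; rewrite -ltNge ltrNl.
  by near: n; exact: nbhs_infty_gtr.
Unshelve. all: by end_near. Qed.
End normal_density.

(** * The Stein equation *)

Lemma le_of_derive_ge0 (R : realType) (f df : R -> R) (x y : R) : x <= y ->
  (forall z, x <= z <= y -> is_derive z (1 : R) f (df z)) ->
  (forall z, x <= z <= y -> 0 <= df z) -> f x <= f y.
Proof.
move=> xy fdf df0.
have [||c] := @MVT_segment R f df x y xy.
- by move=> z; rewrite in_itv/= => /andP[/ltW xz /ltW zy]; apply: fdf; rewrite xz.
- apply: derivable_within_continuous => z; rewrite in_itv/= => xzy.
  by have [] := fdf z xzy.
rewrite in_itv/= => xcy fE; rewrite -subr_ge0 fE mulr_ge0 ?subr_ge0//.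
exact: df0.
Qed.

Section stein_monotone.
Variable R : realType.
Notation phi := (normal_pdf (0 : R) 1).

(** A classical lower bound of the normal tail: minus the derivative of psi is
    at most the density, so psi x is at most the mass of [x, +oo[. *)
Let psi (t : R) := t * (1 + t ^+ 2)^-1 * phi t.

Let is_derive_psi (t : R) : is_derive t (1 : R) psi (- phi t * (1 - 2 / (1 + t ^+ 2) ^+ 2)).
Proof.
have t0 : 1 + t ^+ 2 != 0 by rewrite gt_eqF// ltr_pwDl// sqr_ge0.
have D2 : is_derive t (1 : R) (fun t : R => (1 + t ^+ 2)^-1) (- (1 + t ^+ 2) ^- 2 * (2 * t)).
  have D1 : is_derive t (1 : R) (cst 1 + id ^+ 2 : R -> R) (2 * t).
    have H := is_deriveD (is_derive_cst (1 : R) t (1 : R)) (is_deriveX 2 (is_derive_id t (1 : R))).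
    by apply: (is_derive_eq H); rewrite /GRing.scale/= add0r expr1 mulr1.
  by have := @is_deriveV R (cst 1 + id ^+ 2) t (2 * t) 1 t0 D1.
have D := is_derive_normal_pdf01 t.
rewrite [X in is_derive _ _ X _](_ : _ = ((id * (fun t => (1 + t ^+ 2)^-1)) * phi)%R)//.
apply: is_derive_eq; rewrite /GRing.scale/=.
rewrite -[(id * _)%R t]/(t * (1 + t ^+ 2)^-1); field.
by rewrite t0.
Qed.

Let cvg_psi : psi n%:R @[n --> \oo] --> 0.
Proof.
apply: (@squeeze_cvgr _ _ _ _ (fun=> 0) (fun n => (2 * normal_peak 1) * n.+1%:R^-1)).
- apply: nearW => n; rewrite /psi.
  have n0 : (0 : R) <= n%:R by [].
  have d0 : 0 < 1 + (n%:R : R) ^+ 2 by rewrite ltr_pwDl// sqr_ge0.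
  apply/andP; split.
    by rewrite mulr_ge0 ?normal_pdf_ge0// mulr_ge0// invr_ge0 ltW.
  have pk := @normal_pdf_ub R 0 1 n%:R (oner_neq0 _).
  have pk0 := @normal_pdf_ge0 R 0 1 n%:R.
  have nn : n%:R / (1 + n%:R ^+ 2) <= 2 / n.+1%:R :> R.
    rewrite ler_pdivrMr// mulrAC ler_pdivlMr ?ltr0Sn// -natr1.
    by have := sqr_ge0 (n%:R : R); nra.
  rewrite [leRHS]mulrAC; exact: ler_pM.
- exact: cvg_cst.
- rewrite -[X in _ --> X](mulr0 (2 * normal_peak 1)).
  by apply: cvgM; [exact: cvg_cst | exact: cvg_harmonic].
Qed.

(** If h x <= c then (h - c) phi is nonpositive on ]-oo, x], hence so is F x,
    and both terms are nonpositive. Otherwise h - c >= h x - c = K > 0 on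
    [x, +oo[, where F increases to 0, and the tail bound by psi gives
    F x <= - K psi x, which is the claim. *)
Lemma stein_monotone_ge0 (h F : R -> R) (c x : R) :
  {homo h : x y / x <= y} ->
  (forall t, is_derive t (1 : R) F ((h t - c) * phi t)) ->
  F n%:R @[n --> \oo] --> 0 -> F (- n%:R) @[n --> \oo] --> 0 ->
  0 <= x -> x * (h x - c) * phi x + (1 + x ^+ 2) * F x <= 0.
Proof.
move=> hmono dF Fy FNy x0.
have phi0 t : 0 < phi t by exact: normal_pdf01_gt0.
have [hxc|chx] := leP (h x) c.
  suff Fx : F x <= 0.
    have : 0 <= (1 + x ^+ 2) * - F x by rewrite mulr_ge0 ?addr_ge0 ?sqr_ge0//; lra.
    have : 0 <= x * (c - h x) * phi x by rewrite !mulr_ge0 ?subr_ge0// ltW.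
    by lra.
  apply: (cvgr_to_ge FNy); near=> n.
  have nx : - n%:R <= x by rewrite lerNl; near: n; exact: nbhs_infty_ger.
  rewrite -lerN2; apply: (le_of_derive_ge0 nx (fun z _ => is_deriveN (dF z))).
  move=> z /andP[_ zx]; rewrite -mulNr mulr_ge0 ?(ltW (phi0 _))//.
  by have := hmono _ _ zx; lra.
pose K := h x - c; have K0 : 0 < K by rewrite subr_gt0.
have G0 : F x + K * psi x <= 0.
  have cvgG : (F n%:R + K * psi n%:R) @[n --> \oo] --> 0.
    rewrite -[X in _ --> X]addr0 -[X in _ --> _ + X](mulr0 K).
    by apply: cvgD => //; apply: cvgM => //; exact: cvg_cst.
  apply: (cvgr_to_ge cvgG); near=> n.
  have xn : x <= n%:R by near: n; exact: nbhs_infty_ger.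
  apply: (le_of_derive_ge0 xn (fun z _ => is_deriveD (dF z) (is_deriveZ K (is_derive_psi z)))).
  move=> z /andP[xz _].
  have -> : (h z - c) * phi z + K * (- phi z * (1 - 2 / (1 + z ^+ 2) ^+ 2)) =
    (h z - h x) * phi z + K * phi z * (2 / (1 + z ^+ 2) ^+ 2).
    by rewrite /K; ring.
  rewrite addr_ge0// mulr_ge0 ?subr_ge0 ?hmono ?(ltW (phi0 _))//.
    by rewrite mulr_ge0 ?(ltW (phi0 _))// ltW.
  by rewrite divr_ge0// sqr_ge0.
have d0 : 0 < 1 + x ^+ 2 by rewrite ltr_pwDl// sqr_ge0.
have -> : x * (h x - c) * phi x = (1 + x ^+ 2) * (K * psi x).
  by rewrite /psi /K; field; rewrite gt_eqF.
by rewrite -mulrDr pmulr_rle0// addrC.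
Unshelve. all: by end_near. Qed.

(** Here f = F / phi solves the Stein equation f' = x f + (h - c), and the left
    hand side is phi times the derivative of x f(x): for a nondecreasing test
    function, x f(x) is nonincreasing. The case x <= 0 follows from the
    case x >= 0 by the reflection that replaces h by t |-> - h (- t). *)
Lemma stein_monotone (h F : R -> R) (c x : R) :
  {homo h : x y / x <= y} ->
  (forall t, is_derive t (1 : R) F ((h t - c) * phi t)) ->
  F n%:R @[n --> \oo] --> 0 -> F (- n%:R) @[n --> \oo] --> 0 ->
  x * (h x - c) * phi x + (1 + x ^+ 2) * F x <= 0.
Proof.
move=> hmono dF Fy FNy; have [x0|x0] := leP 0 x; first exact: stein_monotone_ge0.
have phiN t : phi (- t) = phi t by rewrite !normal_pdf01E sqrrN.
have := @stein_monotone_ge0 (fun t => - h (- t)) (fun t => F (- t)) (- c) (- x).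
rewrite !opprK phiN sqrrN => H; apply: le_trans (H _ _ _ _ _) => //.
- by rewrite lerD2r// le_eqVlt; apply/orP; left; apply/eqP; ring.
- by move=> u v uv; rewrite lerN2 hmono// lerN2.
- move=> t; have D := dF (- t).
  have := @is_derive1_comp R F -%R t _ _ D (is_deriveN (is_derive_id t (1 : R))).
  by move=> /is_derive_eq; apply; rewrite phiN; ring.
- under eq_cvg do rewrite opprK. by [].
- lra.
Qed.
End stein_monotone.

Section stein_solution.
Variable R : realType.
Notation mu := (@lebesgue_measure R).
Notation phi := (normal_pdf (0 : R) 1).

Lemma lipschitz1_continuous (h : R -> R) :
  (forall x y, `|h y - h x| <= `|y - x|) -> continuous h.
Proof.
move=> hL x; apply/cvgrPdist_le => e e0; near=> t.
apply: (le_trans (hL _ _)); rewrite distrC.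
by near: t; rewrite /prop_near1; exists e => //= t /= /ltW; rewrite distrC.
Unshelve. all: by end_near. Qed.

Lemma integrable_lipschitz_normal_pdf (h : R -> R) :
  (forall x y, `|h y - h x| <= `|y - x|) ->
  mu.-integrable setT (fun x => (h x * phi x)%:E).
Proof.
move=> hL.
have mh : measurable_fun setT h.
  by apply: continuous_measurable_fun; exact: lipschitz1_continuous.
have mphi : measurable_fun setT phi by exact: measurable_normal_pdf.
have I : mu.-integrable setT (fun x => `|h 0|%:E * (phi x)%:E + `|(x * phi x)%:E|)%E.
  apply: integrableD => //.
    by apply: integrableZl => //; exact: integrable_normal_pdf.
  by apply: integrable_abse; exact: integrable_id_normal_pdf.
apply: le_integrable I => //.
  by apply/measurable_EFinP; exact: measurable_funM.
move=> x _ /=; rewrite lee_fin.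
have p0 : 0 <= phi x by exact: normal_pdf_ge0.
rewrite !normrM (ger0_norm p0) -mulrDl.
rewrite [leRHS]ger0_norm ?mulr_ge0 ?addr_ge0// ler_wpM2r//.
rewrite -[h x](subrK (h 0)) addrC (le_trans (ler_normD _ _))// lerD2l.
by rewrite (le_trans (hL _ _))// subr0.
Qed.

Let cvg_phi : phi n%:R @[n --> \oo] --> 0.
Proof.
apply: (@squeeze_cvgr _ _ _ _ (fun=> 0) (fun n => (2 * normal_peak 1) * n.+1%:R^-1)).
- apply: nearW => n; rewrite normal_pdf_ge0/= normal_pdf01E mulrAC [leLHS]mulrC.
  rewrite ler_wpM2r ?normal_peak_ge0//.
  have n0 : (0 : R) <= n%:R by [].
  have -> : - n%:R ^+ 2 / 2 = - (n%:R ^+ 2 / 2) :> R by rewrite mulNr.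
  have := expR_ge1Dx ((n%:R : R) ^+ 2 / 2) => H.
  rewrite expRN ler_pdivlMr ?ltr0Sn// mulrC ler_pdivrMr ?expR_gt0//.
  apply: le_trans (_ : 2 * (1 + n%:R ^+ 2 / 2) <= _); last by rewrite ler_wpM2l.
  by rewrite -natr1; have := sqr_ge0 ((n%:R : R) - 1); nra.
- exact: cvg_cst.
- rewrite -[X in _ --> X](mulr0 (2 * normal_peak 1)).
  by apply: cvgM; [exact: cvg_cst | exact: cvg_harmonic].
Qed.

(** As g = x f + (h - c), it is enough that x f(x) be 1-Lipschitz, that is
    |D| <= phi, where D = x (h - c) phi + (1 + x^2) F is phi times the
    derivative of x f(x). The map from h to D is linear and sends the identity,
    for which F = - phi, to - phi. Since h is 1-Lipschitz, id + h and id - h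
    are nondecreasing, and [stein_monotone] gives D - phi <= 0 and
    - D - phi <= 0. *)
Lemma stein_solution (h : R -> R) (c := \int[mu]_x (h x * phi x)) :
  (forall x y, `|h y - h x| <= `|y - x|) ->
  exists f g : R -> R,
  [/\ forall x, is_derive x (1 : R) f (g x),
      forall x, g x = x * f x + (h x - c),
      forall x, `|f x| <= 1 &
      forall x y, `|g y - g x| <= 2 * `|y - x|].
Proof.
move=> hL.
have chx := lipschitz1_continuous hL.
have phi0 t : 0 < phi t by exact: normal_pdf01_gt0.
have phin0 t : phi t != 0 by rewrite gt_eqF.
pose k t := (h t - c) * phi t.
have ih := integrable_lipschitz_normal_pdf hL.
have iphi := integrable_normal_pdf (0 : R) 1.
have icphi : mu.-integrable setT (EFin \o (fun x => c * phi x)).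
  by have := integrableZl measurableT c iphi; apply: eq_integrable.
have kE : k = (fun x => h x * phi x - c * phi x).
  by apply/funext => x; rewrite /k mulrBl.
have ik : mu.-integrable setT (EFin \o k).
  by rewrite kE; have := integrableB measurableT ih icphi; apply: eq_integrable.
(* The choice of c centres h - c, so the primitive F vanishes at +oo too. *)
have k0 : \int[mu]_x k x = 0.
  rewrite kE RintegralB// RintegralZl//.
  by rewrite [X in c * X]/Rintegral integral_normal_pdf/= mulr1 subrr.
pose F x := \int[mu]_(t in `]-oo, x]) k t.
have [Fy FNy] := integrable_cumulative_cvg ik.
rewrite k0 in Fy.
have dF t : is_derive t (1 : R) F (k t).
  have [] := @continuous_FTC1 R k -oo%O t (t + 1).
  - by rewrite ltrDl.
  - exact: integrableS ik.
  - by rewrite ltNyr.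
  - apply: cvgM; first by apply: cvgB; [exact: chx | exact: cvg_cst].
    by apply: continuous_normal_pdf; exact: oner_neq0.
  by move=> dF dFE; exact: (DeriveDef dF (etrans (esym (derive1E _ _)) dFE)).
have phiN t : phi (- t) = phi t by rewrite !normal_pdf01E sqrrN.
have dphi (t : R) : is_derive t (1 : R) phi (- (t * phi t)) := is_derive_normal_pdf01 t.
have hB x y : - `|y - x| <= h y - h x <= `|y - x| by rewrite -ler_norml.
pose D x := x * (h x - c) * phi x + (1 + x ^+ 2) * F x.
have D1 x : `|D x| <= phi x.
  have up : D x <= phi x.
    have : x * ((x + h x) - c) * phi x + (1 + x ^+ 2) * (F x - phi x) <= 0.
      apply: (@stein_monotone R (fun x => x + h x) (fun x => F x - phi x)).
      - by move=> u v uv; have := hB u v; rewrite ger0_norm ?subr_ge0//; lra.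
      - move=> t; have E := is_deriveB (dF t) (dphi t).
        by apply: (is_derive_eq E); rewrite /k; ring.
      - by rewrite -[X in _ --> X]subr0; apply: cvgB.
      - by rewrite -[X in _ --> X]subr0; under eq_cvg do rewrite phiN; apply: cvgB.
    by rewrite /D; lra.
  have dn : - D x <= phi x.
    have : x * ((x - h x) - (- c)) * phi x + (1 + x ^+ 2) * (- F x - phi x) <= 0.
      apply: (@stein_monotone R (fun x => x - h x) (fun x => - F x - phi x)).
      - by move=> u v uv; have := hB u v; rewrite ger0_norm ?subr_ge0//; lra.
      - move=> t; have E := is_deriveB (is_deriveN (dF t)) (dphi t).
        by apply: (is_derive_eq E); rewrite /k; ring.
      - by rewrite -[X in _ --> X]subr0 -[X in _ --> X - _]oppr0; apply: cvgB => //; apply: cvgN.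
      - rewrite -[X in _ --> X]subr0 -[X in _ --> X - _]oppr0.
        by under eq_cvg do rewrite phiN; apply: cvgB => //; apply: cvgN.
    by rewrite /D; lra.
  by rewrite ler_norml; apply/andP; split; lra.
pose f x := F x / phi x.
pose g x := x * f x + (h x - c).
have df x : is_derive x (1 : R) f (g x).
  have dV := is_deriveV (phin0 x) (dphi x).
  have E := is_deriveM (dF x) dV.
  apply: (is_derive_eq E); rewrite /GRing.scale/= /g /f /k.
  by field.
have dq x : is_derive x (1 : R) (fun x => x * f x) (D x / phi x).
  have E := is_deriveM (is_derive_id x (1 : R)) (df x).
  apply: (is_derive_eq E); rewrite /GRing.scale/= /g /f /D.
  by field.
have Dphi x : - 1 <= D x / phi x <= 1.
  by rewrite -ler_norml normrM normfV (gtr0_norm (phi0 _)) ler_pdivrMr// mul1r.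
have qL x y : `|y * f y - x * f x| <= `|y - x|.
  wlog xy : x y / x <= y.
    by move=> H; case: (leP x y) => [/H//|/ltW/H]; rewrite distrC (distrC x).
  rewrite (ger0_norm (_ : 0 <= y - x)) ?subr_ge0// ler_norml.
  apply/andP; split.
    have := @le_of_derive_ge0 R (fun x => x + x * f x) (fun x => 1 + D x / phi x) x y xy.
    move=> H; rewrite lerBrDl -subr_ge0.
    suff : x + x * f x <= y + y * f y by lra.
    apply: H => z _; last by have := Dphi z; lra.
  suff : x - x * f x <= y - y * f y by lra.
  apply: (@le_of_derive_ge0 R (fun x => x - x * f x) (fun x => 1 - D x / phi x)) => // z _.
  by have := Dphi z; lra.
exists f, g; split => //.
(* x f(x) vanishes at 0 and is 1-Lipschitz, which bounds f away from 0. *)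
- move=> x; have [->|x0] := eqVneq x 0.
    have := D1 0; rewrite /D mul0r mul0r add0r expr0n addr0 mul1r => H.
    by rewrite /f normrM normfV (gtr0_norm (phi0 _)) ler_pdivrMr// mul1r.
  have := qL 0 x; rewrite mul0r !subr0 normrM.
  by rewrite -[X in _ <= X]mulr1 ler_pM2l// normr_gt0.
- move=> x y.
  rewrite (_ : g y - g x = (y * f y - x * f x) + (h y - h x)); last by rewrite /g; ring.
  rewrite (le_trans (ler_normD _ _))// mulrDl mul1r lerD//.
Qed.
End stein_solution.

(** * Finite measures with equal trigonometric integrals *)

Lemma integrable_bounded d (T : measurableType d) (R : realType) (m : {measure set T -> \bar R})
    (f : T -> R) (M : R) : (m setT < +oo)%E ->
  measurable_fun setT f -> (forall x, `|f x| <= M) -> m.-integrable setT (EFin \o f).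
Proof.
move=> mT mf fM; apply: measurable_bounded_integrable => //.
exists M; split; first exact: num_real.
by move=> M' /ltW MM' x _ /=; exact: le_trans MM'.
Qed.

Section bounded_test_functions.
Variable R : realType.
Variables mu nu : {measure set R -> \bar R}.
Hypotheses (muT : (mu setT < +oo)%E) (nuT : (nu setT < +oo)%E).

(** The functions on which two finite measures agree: a class closed under
    linear combinations and bounded pointwise limits. *)
Definition same_integral (f : R -> R) : Prop :=
  [/\ measurable_fun setT f, exists M, forall x, `|f x| <= M &
      \int[mu]_x f x = \int[nu]_x f x].

Lemma same_integralD (a : R) (f g : R -> R) :
  same_integral f -> same_integral g -> same_integral (fun x => a * f x + g x).
Proof.
move=> [mf [Mf bf] ef] [mg [Mg bg] eg].
have maf : measurable_fun setT (fun x => a * f x) by exact: measurable_funM.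
have baf x : `|a * f x| <= `|a| * Mf by rewrite normrM ler_wpM2l.
split.
- exact: measurable_funD.
- exists (`|a| * Mf + Mg) => x.
  by rewrite (le_trans (ler_normD _ _))// lerD.
- have E (m : {measure set R -> \bar R}) : (m setT < +oo)%E ->
      \int[m]_x (a * f x + g x) = a * \int[m]_x f x + \int[m]_x g x.
    move=> mT.
    rewrite RintegralD//; first by rewrite RintegralZl//; exact: integrable_bounded bf.
      exact: integrable_bounded baf.
    exact: integrable_bounded bg.
  by rewrite !E// ef eg.
Qed.

Lemma same_integral_cvg (u : nat -> R -> R) (f : R -> R) (M : R) :
  (forall n, same_integral (u n)) -> (forall n x, `|u n x| <= M) ->
  (forall x, u n x @[n --> \oo] --> f x) -> same_integral f.
Proof.
move=> su uM uf.
have mu_ n : measurable_fun setT (u n) by case: (su n).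
have mf : measurable_fun setT f by apply: (measurable_fun_cvg mu_) => x _; exact: uf.
have H (m : {measure set R -> \bar R}) : (m setT < +oo)%E ->
    \int[m]_x u n x @[n --> \oo] --> \int[m]_x f x.
  move=> mT; apply: (@Rintegral_dominated_cvg _ _ _ m u f (cst M)) => //.
  by apply: (@integrable_bounded _ _ _ _ _ `|M|).
split => //.
- exists M => x; rewrite ler_norml; apply/andP; split.
    apply: (cvgr_to_ge (uf x)); apply: nearW => n.
    by have := uM n x; rewrite ler_norml => /andP[].
  apply: (cvgr_to_le (uf x)); apply: nearW => n.
  by have := uM n x; rewrite ler_norml => /andP[].
- apply: (cvg_unique _ (H mu muT)) => //.
  rewrite (_ : (fun n => \int[mu]_x u n x) = (fun n => \int[nu]_x u n x)); first exact: H.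
  by apply/funext => n; case: (su n).
Qed.

(** The exponential series of a bounded function is dominated by its value at
    the bound, so agreement on the powers of f passes to exp (a f). *)
Lemma same_integral_exp (f : R -> R) (a : R) :
  (forall j, same_integral (fun x => f x ^+ j)) -> same_integral (fun x => expR (a * f x)).
Proof.
move=> sf; have [_ [M bf] _] := sf 1%N.
have s0 : same_integral (cst 0).
  have := same_integralD (-1) (sf 1%N) (sf 1%N).
  by rewrite (_ : (fun x => _) = cst 0)//; apply/funext => x; rewrite mulN1r addNr.
apply: (@same_integral_cvg (fun n x => series (exp_coeff (a * f x)) n) _ (expR (`|a| * M))).
- elim=> [|n IH].
    by rewrite (_ : (fun x => _) = cst 0)//; apply/funext => x; rewrite /series/= big_geq.
  have := same_integralD (a ^+ n / n`!%:R) (sf n) IH.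
  rewrite (_ : (fun x => _) = (fun x => series (exp_coeff (a * f x)) n.+1))//.
  by apply/funext => x; rewrite seriesSr /exp_coeff/= exprMn; ring.
- move=> n x.
  have M0 : 0 <= `|a| * M.
    by rewrite mulr_ge0// (le_trans _ (bf x))// normr_ge0.
  apply: (@le_trans _ _ (series (exp_coeff (`|a| * M)) n)).
    rewrite /series/= (le_trans (ler_norm_sum _ _ _))// ler_sum// => i _.
    rewrite /exp_coeff/= normrM normrX normfV normr_nat ler_wpM2r ?invr_ge0//.
    rewrite lerXn2r ?nnegrE// normrM ler_wpM2l//.
    by have := bf x; rewrite expr1.
  apply: nondecreasing_cvgn_le; last exact: is_cvg_series_exp_coeff.
  by apply: nondecreasing_series => i _ _; exact: exp_coeff_ge0.
- by move=> x; exact: is_cvg_series_exp_coeff.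
Qed.

Inductive trig_poly : (R -> R) -> Prop :=
| trig_cos t : trig_poly (fun x => cos (t * x))
| trig_sin t : trig_poly (fun x => sin (t * x))
| trig_comb a f g : trig_poly f -> trig_poly g -> trig_poly (fun x => a * f x + g x).

Lemma trig_poly0 : trig_poly (cst 0).
Proof.
have := trig_comb (-1) (trig_cos 0) (trig_cos 0).
by rewrite (_ : (fun x => _) = cst 0)//; apply/funext => x; rewrite mulN1r addNr.
Qed.

Lemma trig_polyZ a f : trig_poly f -> trig_poly (fun x => a * f x).
Proof.
move=> tf; have := trig_comb a tf trig_poly0.
by rewrite (_ : (fun x => _) = (fun x => a * f x))//; apply/funext => x; rewrite addr0.
Qed.

(** The product formulas for sines and cosines; trigonometric polynomials form
    an algebra, so their powers are again available as test functions. *)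
Lemma trig_polyM f g : trig_poly f -> trig_poly g -> trig_poly (fun x => f x * g x).
Proof.
have cosM s g' : trig_poly g' -> trig_poly (fun x => cos (s * x) * g' x).
  elim=> [t|t|a f1 f2 _ IH1 _ IH2].
  - have := trig_polyZ 2^-1 (trig_comb 1 (trig_cos (s - t)) (trig_cos (s + t))).
    rewrite (_ : (fun x => _) = (fun x => cos (s * x) * cos (t * x)))//.
    by apply/funext => x; rewrite mulrBl mulrDl cosB cosD; field.
  - have := trig_polyZ 2^-1 (trig_comb (-1) (trig_sin (s - t)) (trig_sin (s + t))).
    rewrite (_ : (fun x => _) = (fun x => cos (s * x) * sin (t * x)))//.
    by apply/funext => x; rewrite mulrBl mulrDl sinB sinD; field.
  - have := trig_comb a IH1 IH2.
    rewrite (_ : (fun x => _) = (fun x => cos (s * x) * (a * f1 x + f2 x)))//.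
    by apply/funext => x; ring.
have sinM s g' : trig_poly g' -> trig_poly (fun x => sin (s * x) * g' x).
  elim=> [t|t|a f1 f2 _ IH1 _ IH2].
  - have := trig_polyZ 2^-1 (trig_comb 1 (trig_sin (s - t)) (trig_sin (s + t))).
    rewrite (_ : (fun x => _) = (fun x => sin (s * x) * cos (t * x)))//.
    by apply/funext => x; rewrite mulrBl mulrDl sinB sinD; field.
  - have := trig_polyZ 2^-1 (trig_comb (-1) (trig_cos (s + t)) (trig_cos (s - t))).
    rewrite (_ : (fun x => _) = (fun x => sin (s * x) * sin (t * x)))//.
    by apply/funext => x; rewrite mulrBl mulrDl cosB cosD; field.
  - have := trig_comb a IH1 IH2.
    rewrite (_ : (fun x => _) = (fun x => sin (s * x) * (a * f1 x + f2 x)))//.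
    by apply/funext => x; ring.
move=> tf tg; elim: tf => [s|s|a f1 f2 _ IH1 _ IH2]; [exact: cosM|exact: sinM|].
have := trig_comb a IH1 IH2.
rewrite (_ : (fun x => _) = (fun x => (a * f1 x + f2 x) * g x))//.
by apply/funext => x; ring.
Qed.

Lemma trig_polyX f j : trig_poly f -> trig_poly (fun x => f x ^+ j).
Proof.
move=> tf; elim: j => [|j IH].
  have := trig_cos 0; rewrite (_ : (fun x => _) = (fun x => f x ^+ 0))//.
  by apply/funext => x; rewrite mul0r cos0 expr0.
have := trig_polyM tf IH.
by rewrite (_ : (fun x => _) = (fun x => f x ^+ j.+1))//; apply/funext => x; rewrite exprS.
Qed.

Hypothesis same_cos : forall t : R, \int[mu]_x cos (t * x) = \int[nu]_x cos (t * x).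
Hypothesis same_sin : forall t : R, \int[mu]_x sin (t * x) = \int[nu]_x sin (t * x).

Lemma same_integral_trig f : trig_poly f -> same_integral f.
Proof.
elim=> [t|t|a f1 f2 _ IH1 _ IH2]; last exact: same_integralD.
- split => //.
    apply: measurableT_comp; last by apply: measurable_funM.
    by apply: continuous_measurable_fun; exact: continuous_cos.
  by exists 1 => x; rewrite ler_norml cos_le1 cos_geN1.
- split => //.
    apply: measurableT_comp; last by apply: measurable_funM.
    by apply: continuous_measurable_fun; exact: continuous_sin.
  by exists 1 => x; rewrite ler_norml sin_le1 sin_geN1.
Qed.

Lemma same_integral_double_exp_trig (k : R) f :
  trig_poly f -> same_integral (fun x => expR (k * expR (f x))).
Proof.
move=> tf; apply: same_integral_exp => j.
rewrite (_ : (fun x => _) = (fun x => expR (j%:R * f x))); last first.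
  by apply/funext => x; rewrite expRM_natl.
by apply: same_integral_exp => i; apply: same_integral_trig; exact: trig_polyX.
Qed.

Lemma cvg_natM_sin_div (x : R) : n.+1%:R * sin (x / n.+1%:R) @[n --> \oo] --> x.
Proof.
apply/cvgrPdist_le => e e0.
have D0 : is_derive (0 : R) (1 : R) (sin - id) 0.
  by apply: is_derive_eq; rewrite cos0 subrr.
have e1 : 0 < e / (`|x| + 1) by rewrite divr_gt0// ltr_wpDl.
have [] := @derivable_lipschitz_at R (sin - id) 0 0 (e / (`|x| + 1)) _ _ e1.
- by case: D0.
- by rewrite derive1E; case: D0 => _ ->; rewrite normr0.
move=> r r0 Hr; near=> n.
have xr : `|x / n.+1%:R - 0| < r.
  rewrite subr0 normrM normfV normr_nat ltr_pdivrMr ?ltr0Sn// mulrC -ltr_pdivrMr//.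
  apply: lt_trans (_ : n%:R < _); last by rewrite ltr_nat.
  by near: n; exact: nbhs_infty_gtr.
have := Hr _ xr; rewrite [X in `|X|](_ : _ = sin (x / n.+1%:R) - x / n.+1%:R); last first.
  by rewrite -[LHS]/(sin _ - _ - (sin 0 - 0)) sin0 !subr0.
rewrite subr0 add0r normrM normfV normr_nat => H.
have -> : x - n.+1%:R * sin (x / n.+1%:R) = - (n.+1%:R * (sin (x / n.+1%:R) - x / n.+1%:R)).
  by field.
rewrite normrN normrM normr_nat.
apply: (@le_trans _ _ (n.+1%:R * (e / (`|x| + 1) * (`|x| / n.+1%:R)))).
  by rewrite ler_wpM2l.
have -> : n.+1%:R * (e / (`|x| + 1) * (`|x| / n.+1%:R)) = e * (`|x| / (`|x| + 1)).
  by field; rewrite !gt_eqF// ?ltr_wpDl// ltr0Sn.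
by rewrite ler_piMr ?(ltW e0)// ler_pdivrMr ?ltr_wpDl// mul1r lerDl.
Unshelve. all: by end_near. Qed.

(** The functions lam n sin (x / n) are trigonometric polynomials that converge
    to lam x without a common bound. The double exponential restores one: for
    k >= 0 all the functions exp (- k exp _) lie between 0 and 1. *)
Lemma same_integral_exp_exp (k lam : R) : 0 <= k ->
  same_integral (fun x => expR (- k * expR (lam * x))).
Proof.
move=> k0; apply: (@same_integral_cvg
  (fun n x => expR (- k * expR (lam * (n.+1%:R * sin (n.+1%:R^-1 * x))))) _ 1).
- move=> n; apply: (@same_integral_double_exp_trig (- k)
    (fun x => lam * (n.+1%:R * sin (n.+1%:R^-1 * x)))).
  by apply: trig_polyZ; apply: trig_polyZ; exact: trig_sin.
- move=> n x; rewrite ger0_norm ?expR_ge0// -expR0 ler_expR mulNr oppr_le0.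
  by rewrite mulr_ge0// expR_ge0.
- move=> x; apply: continuous_cvg; first exact: continuous_expR.
  apply: cvgM; first exact: cvg_cst.
  apply: continuous_cvg; first exact: continuous_expR.
  apply: cvgM; first exact: cvg_cst.
  under eq_cvg do rewrite (mulrC _ x).
  exact: cvg_natM_sin_div.
Qed.

Lemma expRN_le_inv (y : R) (n : nat) : n%:R <= y -> expR (- y) <= n.+1%:R^-1.
Proof.
move=> ny; rewrite expRN lef_pV2 ?posrE ?expR_gt0// ?ltr0Sn//.
by rewrite -natr1 addrC (le_trans _ (expR_ge1Dx y))// lerD2l.
Qed.

(** The parameters are chosen so that the n-th function is
    exp (- exp (n + n^2 (x - b))). The exponent n + n^2 (x - b) tends to -oo
    for x < b and to +oo for x >= b; the summand n decides the case x = b. *)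
Lemma same_integral_ray (b : R) : same_integral \1_(`]-oo, b[).
Proof.
apply: (@same_integral_cvg
  (fun n x => expR (- expR (n%:R - n%:R ^+ 2 * b) * expR (n%:R ^+ 2 * x))) _ 1).
- by move=> n; apply: same_integral_exp_exp; exact: expR_ge0.
- move=> n x; rewrite ger0_norm ?expR_ge0// -expR0 ler_expR mulNr oppr_le0.
- move=> x; rewrite (_ : (fun n => _) =
    (fun n => expR (- expR (n%:R + n%:R ^+ 2 * (x - b))))); last first.
    by apply/funext => n; rewrite mulNr -expRD; congr (expR (- expR _)); ring.
  have n0 n : (0 : R) <= n%:R by [].
  rewrite indicE; have [xb|bx] := ltP x b.
    rewrite mem_set/= ?in_itv//=.
    apply: (@squeeze_cvgr _ _ _ _ (fun n => 1 - n.+1%:R^-1) (fun=> 1)).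
    - near=> n; apply/andP; split; last first.
        by rewrite -[leRHS]expR0 ler_expR oppr_le0 expR_ge0.
      apply: le_trans (expR_ge1Dx _); rewrite lerD2l lerN2.
      rewrite -[X in expR X]opprK; apply: expRN_le_inv.
      have nd : 2 / (b - x) <= n%:R by near: n; exact: nbhs_infty_ger.
      rewrite ler_pdivrMr ?subr_gt0// in nd.
      have := n0 n; rewrite expr2; nra.
    - rewrite -[X in _ --> X]subr0; apply: cvgB; [exact: cvg_cst | exact: cvg_harmonic].
    - exact: cvg_cst.
  rewrite memNset/= ?in_itv/=; last by apply/negP; rewrite -leNgt.
  apply: (@squeeze_cvgr _ _ _ _ (fun=> 0) (fun n => n.+1%:R^-1)).
  - apply: nearW => n; rewrite expR_ge0/=; apply: expRN_le_inv.
    apply: le_trans (expR_ge1Dx _).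
    have : 0 <= n%:R ^+ 2 * (x - b) by rewrite mulr_ge0 ?sqr_ge0 ?subr_ge0.
    by lra.
  - exact: cvg_cst.
  - exact: cvg_harmonic.
Unshelve. all: by end_near. Qed.

(** Uniqueness theorem for characteristic functions, without Fourier inversion:
    agreement on trigonometric polynomials propagates to exponentials of
    exponentials of them, then by limits to exp (- k exp (lam x)) and to the
    indicators of rays, which determine a finite measure. *)
Lemma measure_eq_of_trig_integrals A : measurable A -> mu A = nu A.
Proof.
have lt (m : {measure set R -> \bar R}) (B : set R) : (m setT < +oo)%E -> measurable B ->
    (m B < +oo)%E.
  by move=> mT mB; apply: le_lt_trans mT; apply: le_measure; rewrite ?inE.
have fin (m : {measure set R -> \bar R}) (B : set R) : (m setT < +oo)%E -> measurable B ->
    m B = (\int[m]_x \1_B x)%:E.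
  move=> mT mB; rewrite /Rintegral integral_indic// setIT fineK//.
  by rewrite ge0_fin_numE// lt.
(* An increasing sequence of rays exhausts the line, with finite masses. *)
pose g n : set R := `]-oo, n%:R[%classic.
have gI : setI_closed (@RGenInftyO.G R).
  move=> _ _ [x ->] [y ->]; exists (Num.min x y).
  apply/seteqP; split => z /=; rewrite !in_itv/= lt_min.
    by move=> [-> ->].
  by move=> /andP[].
have Gg n : @RGenInftyO.G R (g n) by exists n%:R.
have gT : \bigcup_n g n = setT.
  rewrite -subTset => x _ /=; exists (Num.bound `|x|) => //=; rewrite /g/= in_itv/=.
  by rewrite (le_lt_trans (ler_norm x))// archi_boundP.
have GE B : @RGenInftyO.G R B -> mu B = nu B.
  move=> [x ->]; have [_ _ E] := same_integral_ray x.
  by rewrite (fin mu _ muT)// (fin nu _ nuT)// E.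
have gfin n : (mu (g n) < +oo)%E by apply: (lt mu _ muT); rewrite /g.
move=> mA.
exact: (@measure_unique _ R R (@RGenInftyO.G R) g (RGenInftyO.measurableE R) gI Gg gT mu nu GE gfin A mA).
Qed.
End bounded_test_functions.

(** * Mixtures of laws *)

Definition is_law_mixture d (T : measurableType d) (R : realType) (P : probability T R)
    (U V W : T -> R) (rho : R) : Prop := forall A : set R, measurable A ->
  P (U @^-1` A) = (rho%:E * P (V @^-1` A) + (1 - rho)%:E * P (W @^-1` A))%E.

Section law_mixture.
Context d (T : measurableType d) (R : realType) (P : probability T R).
Variables (U V W : {RV P >-> R}) (rho : R).
Hypothesis rho01 : 0 <= rho <= 1.

Let rho0 : 0 <= rho. Proof. by case/andP: rho01. Qed.
Let rho1 : 0 <= 1 - rho. Proof. by rewrite subr_ge0; case/andP: rho01. Qed.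

Let mixture : {measure set R -> \bar R} :=
  measure_add (mscale (NngNum rho0) (distribution P V))
              (mscale (NngNum rho1) (distribution P W)).

Let mixtureE A : mixture A =
  (rho%:E * distribution P V A + (1 - rho)%:E * distribution P W A)%E.
Proof. exact: measure_addE. Qed.

Let ge0_integral_mixture (f : R -> \bar R) :
  measurable_fun setT f -> (forall x, 0 <= f x)%E ->
  (\int[mixture]_x f x = rho%:E * \int[P]_w f (V w) + (1 - rho)%:E * \int[P]_w f (W w))%E.
Proof.
move=> mf f0; rewrite /mixture ge0_integral_measure_add//.
rewrite !ge0_integral_mscale// !ge0_integral_distribution//.
Qed.

Lemma ge0_integral_law_mixture (f : R -> \bar R) : is_law_mixture P U V W rho ->
  measurable_fun setT f -> (forall x, 0 <= f x)%E ->
  (\int[P]_w f (U w) = rho%:E * \int[P]_w f (V w) + (1 - rho)%:E * \int[P]_w f (W w))%E.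
Proof.
move=> lawU mf f0.
rewrite -ge0_integral_mixture// -[LHS](ge0_integral_distribution U)//.
by apply: eq_measure_integral => A mA _; rewrite mixtureE; exact: lawU.
Qed.

Let integral_of_ge0_mixture (nu : {measure set R -> \bar R}) (f : R -> R) :
  (forall g : R -> \bar R, measurable_fun setT g -> (forall x, 0 <= g x)%E ->
    (\int[nu]_x g x = rho%:E * \int[P]_w g (V w) + (1 - rho)%:E * \int[P]_w g (W w))%E) ->
  measurable_fun setT f ->
  P.-integrable setT (EFin \o (f \o V)) -> P.-integrable setT (EFin \o (f \o W)) ->
  nu.-integrable setT (EFin \o f) /\
  \int[nu]_x f x = rho * \int[P]_w f (V w) + (1 - rho) * \int[P]_w f (W w).
Proof.
move=> nuE mf iV iW.
have mfE : measurable_fun setT (EFin \o f) by exact/measurable_EFinP.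
have key (g : R -> \bar R) : measurable_fun setT g -> (forall x, 0 <= g x)%E ->
    (forall x, g x <= `|(f x)%:E|)%E ->
    [/\ \int[P]_w g (V w) \is a fin_num, \int[P]_w g (W w) \is a fin_num &
       \int[nu]_x g x \is a fin_num]%E.
  move=> mg g0 gf.
  have fn (Y : {RV P >-> R}) : P.-integrable setT (EFin \o (f \o Y)) ->
      (\int[P]_w g (Y w) \is a fin_num)%E.
    move=> iY; rewrite ge0_fin_numE ?integral_ge0//.
    have /integrableP[mY] := iY; apply: le_lt_trans; apply: ge0_le_integral => //.
      exact: (measurableT_comp mg).
    exact: measurableT_comp.
  have fV := fn V iV; have fW := fn W iW; split => //.
  by rewrite nuE// fin_numD !fin_numM.
have mabs : measurable_fun setT (fun x => `|(f x)%:E|)%E by exact: measurableT_comp.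
split.
  apply/integrableP; split => //.
  have [//|_ _ fin] := key (fun x => `|(f x)%:E|)%E mabs (fun x => abse_ge0 _).
  by rewrite -ge0_fin_numE// integral_ge0.
have mp : measurable_fun setT (EFin \o f)^\+%E by exact: measurable_funepos.
have mn : measurable_fun setT (EFin \o f)^\-%E by exact: measurable_funeneg.
have [|pV pW pU] := key (EFin \o f)^\+%E mp (fun x => funepos_ge0 _ _).
  by move=> x; rewrite funeposE /= -EFin_max lee_fin ge_max ler_norm normr_ge0.
have [|nV nW nU] := key (EFin \o f)^\-%E mn (fun x => funeneg_ge0 _ _).
  by move=> x; rewrite funenegE /= -EFin_max lee_fin ge_max -normrN ler_norm normr_ge0.
rewrite /Rintegral.
have E (Y : {RV P >-> R}) : (\int[P]_w (f (Y w))%:E =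
    \int[P]_w ((EFin \o f)^\+ (Y w)) - \int[P]_w ((EFin \o f)^\- (Y w)))%E.
  by rewrite [LHS]integralE; congr (_ - _)%E; apply: eq_integral => w _;
    rewrite ?funeposE ?funenegE.
have -> : (\int[nu]_x (f x)%:E =
    \int[nu]_x ((EFin \o f)^\+ x) - \int[nu]_x ((EFin \o f)^\- x))%E.
  exact: integralE.
rewrite !E fineB//.
rewrite (fineB pV nV) (fineB pW nW) !nuE//.
rewrite -(fineK pV) -(fineK pW) -(fineK nV) -(fineK nW) -!EFinM -!EFinD /=.
by ring.
Qed.

Lemma integral_law_mixture (f : R -> R) : is_law_mixture P U V W rho ->
  measurable_fun setT f ->
  P.-integrable setT (EFin \o (f \o V)) -> P.-integrable setT (EFin \o (f \o W)) ->
  P.-integrable setT (EFin \o (f \o U)) /\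
  \int[P]_w f (U w) = rho * \int[P]_w f (V w) + (1 - rho) * \int[P]_w f (W w).
Proof.
move=> lawU mf iV iW.
have mfE : measurable_fun setT (EFin \o f) by exact/measurable_EFinP.
have [|iU <-] := integral_of_ge0_mixture (nu := distribution P U) _ mf iV iW.
  by move=> g mg g0; rewrite ge0_integral_distribution// ge0_integral_law_mixture.
have iU' : P.-integrable setT (EFin \o (f \o U)).
  apply/integrableP; split; first exact: (measurableT_comp mfE).
  have /integrableP[_] := iU; rewrite ge0_integral_distribution//.
  exact: measurableT_comp.
by split => //; rewrite /Rintegral integral_distribution.
Qed.

(** The mixture of the laws of V and W is a finite measure with the same
    trigonometric integrals as the law of U. *)
Lemma law_mixture_of_charfun :
  (forall t, \int[P]_w cos (t * U w) =
     rho * \int[P]_w cos (t * V w) + (1 - rho) * \int[P]_w cos (t * W w)) ->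
  (forall t, \int[P]_w sin (t * U w) =
     rho * \int[P]_w sin (t * V w) + (1 - rho) * \int[P]_w sin (t * W w)) ->
  is_law_mixture P U V W rho.
Proof.
move=> hcos hsin A mA.
have E (f : R -> R) : measurable_fun setT f -> (exists M, forall x, `|f x| <= M) ->
    \int[P]_w f (U w) = rho * \int[P]_w f (V w) + (1 - rho) * \int[P]_w f (W w) ->
    \int[distribution P U]_x f x = \int[mixture]_x f x.
  move=> mf [M fM] H.
  have PT : (P setT < +oo)%E by rewrite probability_setT ltry.
  have iY (Y : {RV P >-> R}) : P.-integrable setT (EFin \o (f \o Y)).
    apply: (@integrable_bounded _ _ _ P (f \o Y) M).
    - exact: PT.
    - exact: (measurableT_comp mf).
    - by move=> x; exact: fM.
  have mfE : measurable_fun setT (EFin \o f) by exact/measurable_EFinP.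
  have [_ ->] := integral_of_ge0_mixture (nu := mixture) ge0_integral_mixture mf (iY V) (iY W).
  by rewrite -H; congr fine; exact: (integral_distribution mfE (iY U)).
suff : distribution P U A = mixture A by rewrite mixtureE.
have fU : (distribution P U setT < +oo)%E by rewrite probability_setT ltry.
have fm : (mixture setT < +oo)%E by rewrite mixtureE !probability_setT !mule1 -EFinD ltry.
apply: (measure_eq_of_trig_integrals fU fm) => // t; apply: E => //.
- apply: measurableT_comp; last by apply: measurable_funM.
  by apply: continuous_measurable_fun; exact: continuous_cos.
- by exists 1 => x; rewrite ler_norml cos_le1 cos_geN1.
- apply: measurableT_comp; last by apply: measurable_funM.
  by apply: continuous_measurable_fun; exact: continuous_sin.
- by exists 1 => x; rewrite ler_norml sin_le1 sin_geN1.
Qed.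
End law_mixture.

(** * Independence *)

Lemma integrable_of_distribution d d' (T : measurableType d) (S : measurableType d')
    (R : realType) (P : probability T R) (X : {mfun T >-> S}) (f : S -> \bar R) :
  (distribution P X).-integrable setT f -> P.-integrable setT (f \o X).
Proof.
move=> /integrableP[mf]; rewrite ge0_integral_distribution//; last exact: measurableT_comp.
by move=> fin; apply/integrableP; split => //; exact: measurableT_comp.
Qed.

Section independent_pair.
Context d d1 d2 (T : measurableType d) (S1 : measurableType d1) (S2 : measurableType d2).
Context (R : realType) (P : probability T R).
Variables (U : {mfun T >-> S1}) (V : {mfun T >-> S2}).

Hypothesis indepUV : forall A B, measurable A -> measurable B ->
  P (U @^-1` A `&` V @^-1` B) = (P (U @^-1` A) * P (V @^-1` B))%E.

Let mpair : measurable_fun setT (fun w => (U w, V w)).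
Proof. by apply: measurable_fun_pair. Qed.

Let UV : {mfun T >-> (S1 * S2)%type} :=
  HB.pack (fun w => (U w, V w)) (isMeasurableFun.Build _ _ _ _ _ mpair).

Let lawUV A : measurable A -> (distribution P U \x distribution P V)%E A = distribution P UV A.
Proof.
by move=> mA; apply: product_measure_unique => // B C mB mC; rewrite -[RHS]indepUV.
Qed.

Let integral_lawUV (F : S1 * S2 -> \bar R) :
  (\int[distribution P U \x distribution P V]_z F z = \int[distribution P UV]_z F z)%E.
Proof. by apply: eq_measure_integral => A mA _; exact: lawUV. Qed.

Lemma ge0_integral_independent (F : S1 * S2 -> \bar R) :
  measurable_fun setT F -> (forall z, 0 <= F z)%E ->
  (\int[P]_w F (U w, V w) = \int[P]_w \int[P]_v F (U w, V v))%E.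
Proof.
move=> mF F0.
rewrite -[LHS](ge0_integral_distribution UV)//.
have mH : measurable_fun setT (fubini_F (distribution P V) F).
  exact: measurable_fun_fubini_tonelli_F.
have H0 x : (0 <= fubini_F (distribution P V) F x)%E by exact: integral_ge0.
rewrite -integral_lawUV fubini_tonelli1// (ge0_integral_distribution U mH H0).
apply: eq_integral => w _; rewrite /fubini_F /=.
rewrite ge0_integral_distribution//.
exact: measurableT_comp.
Qed.

(** Independence makes the joint law a product, to which Fubini applies. *)
Lemma integral_independent (F : S1 * S2 -> R) :
  measurable_fun setT F ->
  (forall x, P.-integrable setT (fun v => (F (x, V v))%:E)) ->
  (\int[P]_w \int[P]_v `|F (U w, V v)|%:E < +oo)%E ->
  P.-integrable setT (fun w => (F (U w, V w))%:E) /\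
  \int[P]_w F (U w, V w) = \int[P]_w (\int[P]_v F (U w, V v)).
Proof.
move=> mF iF fin.
have mFE : measurable_fun setT (EFin \o F) by exact/measurable_EFinP.
have iUV : P.-integrable setT (fun w => (F (U w, V w))%:E).
  apply/integrableP; split; first exact: (measurableT_comp mFE).
  rewrite (ge0_integral_independent (F := fun z => `|(F z)%:E|%E))//.
  exact: measurableT_comp.
split => //.
have iprod : (distribution P U \x distribution P V)%E.-integrable setT (EFin \o F).
  apply/integrableP; split => //.
  rewrite integral_lawUV ge0_integral_distribution//; last exact: measurableT_comp.
  by have /integrableP[] := iUV.
rewrite /Rintegral; congr fine.
rewrite -[LHS](integral_distribution (X := UV) mFE iUV).
rewrite -integral_lawUV -integral12_prod_meas1//.
have inner x : fubini_F (distribution P V) (EFin \o F) x = (\int[P]_v F (x, V v))%:E.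
  rewrite /fubini_F integral_distribution//.
  - by rewrite /Rintegral fineK//; apply: integrable_fin_num => //; exact: iF.
  - exact: measurableT_comp.
  - exact: iF.
have ifub : (distribution P U).-integrable setT (fubini_F (distribution P V) (EFin \o F)).
  exact: integrable_fubini_F iprod.
rewrite [LHS](integral_distribution (measurable_int _ ifub) (integrable_of_distribution ifub)).
by apply: eq_integral => w _; exact: inner.
Qed.
End independent_pair.

(** * Sums of random variables *)

Section random_variable_sum.
Context d (T : measurableType d) (R : realType) (P : probability T R).

(** The index set is a list, so that one summand can be isolated from the
    others. *)
Definition sumRV (X : nat -> {RV P >-> R}) (J : seq nat) (w : T) : R := \sum_(i <- J) X i w.

Lemma measurable_sumRV X J : measurable_fun setT (sumRV X J).
Proof. exact: measurable_sum. Qed.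

HB.instance Definition _ X J := isMeasurableFun.Build _ _ _ _ (sumRV X J) (@measurable_sumRV X J).

Variable X : nat -> {RV P >-> R}.
Hypothesis indepX : mutually_independent P (fun j => X j : T -> R).

Let cylinders (J : seq nat) : set (set T) :=
  [set C | exists2 B : nat -> set R, (forall i, measurable (B i)) &
     C = \bigcap_(i in [set` J]) X i @^-1` B i].

Let cylindersI J : setI_closed (cylinders J).
Proof.
move=> _ _ [B mB ->] [C mC ->]; exists (fun i => B i `&` C i).
  by move=> i; exact: measurableI.
by rewrite -bigcapI.
Qed.

Let cylinders_measurable J : cylinders J `<=` measurable.
Proof.
move=> _ [B mB ->]; apply: bigcap_measurableType => // i _; exact: measurable_funPTI.
Qed.

Let cylindersT J : cylinders J setT.
Proof.
exists (fun=> setT) => //; apply/esym; rewrite -subTset => w _ i _ //.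
Qed.

Let independent_cylinder j J (A : set R) (C : set T) : j \notin J -> uniq J ->
  measurable A -> cylinders J C ->
  P (C `&` X j @^-1` A) = (P (X j @^-1` A) * P C)%E.
Proof.
move=> jJ uJ mA [B mB ->].
pose B' k := if k == j then A else B k.
have mB' k : measurable (B' k) by rewrite /B'; case: ifP.
have B'E i : i \in J -> B' i = B i.
  by move=> iJ; rewrite /B'; case: eqP => // ij; rewrite -ij iJ in jJ.
have eqC : \bigcap_(i in [set` J]) X i @^-1` B' i = \bigcap_(i in [set` J]) X i @^-1` B i.
  by apply: eq_bigcapr => i /= iJ; rewrite B'E.
have -> : (\bigcap_(i in [set` J]) X i @^-1` B i) `&` X j @^-1` A =
    \bigcap_(i in [set` j :: J]) X i @^-1` B' i.
  rewrite -eqC setIC; apply/seteqP; split => w /=.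
    move=> [wA wB] i /=; rewrite in_cons => /orP[/eqP ->|/wB//].
    by rewrite /B' eqxx.
  move=> wB; split; first by have := wB j; rewrite /= mem_head /B' eqxx; exact.
  by move=> i /= iJ; apply: wB; rewrite /= in_cons iJ orbT.
rewrite (indepX (J := j :: J) (B := B')) ?cons_uniq ?jJ// big_cons /B' eqxx -/B'.
rewrite -eqC (indepX (J := J) (B := B'))//.
Qed.

(** On the pi-system of the cylinders over J the measures
    C |-> P (C /\ X j in A) and C |-> P (X j in A) P C agree, hence they agree
    on the generated sigma-algebra, for which the sum over J is measurable. *)
Lemma independent_sumRV j J : j \notin J -> uniq J -> forall A B : set R,
  measurable A -> measurable B ->
  P (X j @^-1` A `&` sumRV X J @^-1` B) = (P (X j @^-1` A) * P (sumRV X J @^-1` B))%E.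
Proof.
move=> jJ uJ A B mA mB.
pose G := cylinders J.
have mXA : measurable (X j @^-1` A) by exact: measurable_funPTI.
pose m1 : {measure set T -> \bar R} := mrestr P mXA.
pose r := fine (P (X j @^-1` A)).
have r0 : 0 <= r by exact: fine_ge0.
have rE : r%:E = P (X j @^-1` A) by rewrite fineK// fin_num_measure.
pose m2 : {measure set T -> \bar R} := mscale (NngNum r0) P.
have key E : <<s G >> E -> m1 E = m2 E.
  apply: (g_sigma_algebra_measure_unique G (@cylinders_measurable J) (fun=> setT)).
  - by move=> _; exact: cylindersT.
  - by rewrite -subTset => w _; exists 0%N.
  - exact: cylindersI.
  - move=> C GC; have -> : m2 C = (P (X j @^-1` A) * P C)%E by rewrite -rE.
    exact: (independent_cylinder jJ uJ mA GC).
  - move=> _; have -> : m1 setT = P (X j @^-1` A) by rewrite -[LHS]/(P (_ `&` _)) setTI.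
    by rewrite -ge0_fin_numE// fin_num_measure.
have sub : <<s G >> (sumRV X J @^-1` B).
  pose T' := g_sigma_algebraType G.
  pose h (i : nat) : T' -> R := if i \in J then X i else cst 0.
  have mh i : measurable_fun setT (h i).
    rewrite /h; case: ifP => // iJ _ C mC; rewrite setTI.
    apply: sub_sigma_algebra; exists (fun k => if k == i then C else setT).
      by move=> k; case: ifP.
    apply/seteqP; split => w /=.
      by move=> wC k /= kJ; case: eqP => // ->.
    by move=> /(_ i iJ); rewrite /= eqxx.
  have := @measurable_sum _ T' R setT nat J h mh measurableT B mB.
  rewrite setTI; congr (<<s _ >> _); apply/funext => w; congr B.
  by rewrite /sumRV !big_seq; apply: eq_bigr => i iJ; rewrite /h iJ.
have := key _ sub; have -> : m2 (sumRV X J @^-1` B) = (r%:E * P (sumRV X J @^-1` B))%E by [].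
by rewrite rE => <-; rewrite setIC.
Qed.

End random_variable_sum.

Section same_law.
Context d (T : measurableType d) (R : realType) (P : probability T R).
Variables U V : {RV P >-> R}.

(** Equality of laws is a degenerate mixture, to which the results on mixtures
    specialize. *)
Lemma same_law_mixtureP : (forall A : set R, measurable A -> P (U @^-1` A) = P (V @^-1` A)) <->
  is_law_mixture P U V V 1.
Proof. by split=> H A mA; have := H A mA; rewrite subrr mul0e adde0 mul1e. Qed.

Lemma integral_same_law (f : R -> R) :
  (forall A : set R, measurable A -> P (U @^-1` A) = P (V @^-1` A)) ->
  measurable_fun setT f -> P.-integrable setT (EFin \o (f \o V)) ->
  P.-integrable setT (EFin \o (f \o U)) /\ \int[P]_w f (U w) = \int[P]_w f (V w).
Proof.
move=> /same_law_mixtureP H mf iV.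
have h01 : 0 <= (1 : R) <= 1 by rewrite lexx ler01.
have [iU ->] := integral_law_mixture h01 H mf iV iV.
by rewrite subrr mul0r addr0 mul1r.
Qed.
End same_law.

Lemma Rintegral_independent_mul d (T : measurableType d) (R : realType) (P : probability T R)
    (U V : {RV P >-> R}) (a b : R -> R) :
  (forall A B, measurable A -> measurable B ->
    P (U @^-1` A `&` V @^-1` B) = (P (U @^-1` A) * P (V @^-1` B))%E) ->
  measurable_fun setT a -> measurable_fun setT b ->
  P.-integrable setT (EFin \o (a \o U)) -> P.-integrable setT (EFin \o (b \o V)) ->
  P.-integrable setT (fun w => (a (U w) * b (V w))%:E) /\
  \int[P]_w (a (U w) * b (V w)) = \int[P]_w a (U w) * \int[P]_w b (V w).
Proof.
move=> ind ma mb ia ib.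
pose F (z : R * R) := a z.1 * b z.2.
have mF : measurable_fun setT F.
  by apply: measurable_funM; apply: measurableT_comp => //; exact: measurable_snd.
have iF x : P.-integrable setT (fun v => (F (x, V v))%:E).
  by have := integrableZl measurableT (a x) ib; apply: eq_integrable.
have fin : (\int[P]_w \int[P]_v `|F (U w, V v)|%:E < +oo)%E.
  have ibn := integrable_norm ib.
  have E w : (\int[P]_v `|F (U w, V v)|%:E = `|a (U w)|%:E * \int[P]_v `|b (V v)|%:E)%E.
    rewrite -integralZl//; apply: eq_integral => v _.
    by rewrite /F normrM EFinM.
  under eq_integral do rewrite E.
  have fb := integrable_fin_num measurableT ibn.
  rewrite -(fineK fb) integralZr//; last exact: (integrable_norm ia).
  have fa : (\int[P]_x `|a (U x)|%:E)%E \is a fin_num.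
    exact: (integrable_fin_num measurableT (integrable_norm ia)).
  by rewrite -(fineK fa) -EFinM ltry.
have [iUV E] := integral_independent ind mF iF fin.
split => //; rewrite [LHS]E.
rewrite -RintegralZr//; apply: eq_Rintegral => w _.
exact: (RintegralZl (a (U w)) measurableT ib).
Qed.

(** Freezing of an independent index: the random objects G n are functions of
    the sigma-algebra generated by S, from which M is independent. *)
Lemma Rintegral_random_index d (T : measurableType d) (R : realType) (P : probability T R)
    (M : {RV P >-> nat}) (G : nat -> T -> R) (S : set (set T)) :
  S `<=` measurable ->
  (forall A B, <<s S >> B -> P (M @^-1` A `&` B) = (P (M @^-1` A) * P B)%E) ->
  (forall n, measurable_fun setT (G n : g_sigma_algebraType S -> R)) ->
  (forall n, P.-integrable setT (EFin \o G n)) ->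
  P.-integrable setT (fun w => (\int[P]_v `|G (M w) v|)%:E) ->
  P.-integrable setT (fun w => (G (M w) w)%:E) /\
  \int[P]_w G (M w) w = \int[P]_w (\int[P]_v G (M w) v).
Proof.
move=> Sm ind mG iG imean.
pose T' := g_sigma_algebraType S.
have mid : measurable_fun setT (idfun : T -> T').
  move=> _ B mB; rewrite setTI; move: B mB.
  by apply: smallest_sub => //; exact: sigma_algebra_measurable.
(* The sample point itself, seen through the sub-sigma-algebra generated by S,
   is a random element independent of M. *)
pose V : {mfun T >-> T'} := HB.pack (idfun : T -> T') (isMeasurableFun.Build _ _ _ _ _ mid).
pose F (z : nat * T') := G z.1 z.2.
have mF : measurable_fun setT F.
  move=> _ B mB; rewrite setTI.
  have -> : F @^-1` B = \bigcup_n ([set n] `*` (G n @^-1` B)).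
    apply/seteqP; split => [[n v] /= Bv|[n v] [k _ [/= -> //]]].
    by exists n.
  apply: bigcup_measurable => n _; apply: measurableX => //.
  by rewrite -[X in measurable X]setTI; exact: (mG n measurableT).
have indMV A B : measurable A -> measurable B ->
    P (M @^-1` A `&` V @^-1` B) = (P (M @^-1` A) * P (V @^-1` B))%E.
  by move=> _ mB; exact: ind.
have iF x : P.-integrable setT (fun v => (F (x, V v))%:E) by exact: iG.
have fin : (\int[P]_w \int[P]_v `|F (M w, V v)|%:E < +oo)%E.
  have := integrable_lty measurableT imean; congr (_ < _)%E.
  apply: eq_integral => w _; rewrite /Rintegral fineK//.
  by apply: integrable_fin_num => //; exact: (integrable_norm (iG (M w))).
exact: (integral_independent indMV mF iF fin).
Qed.

Lemma Rintegral_prob_cst d (T : measurableType d) (R : realType) (P : probability T R) (c : R) :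
  \int[P]_w c = c.
Proof.
rewrite Rintegral_cst//; have -> : fine (P setT) = 1 by rewrite probability_setT.
by rewrite mulr1.
Qed.

Lemma sumRV_iota d (T : measurableType d) (R : realType) (P : probability T R)
    (X : nat -> {RV P >-> R}) (n : nat) (w : T) :
  sumRV X (iota 0 n) w = \sum_(i < n) X i w.
Proof. by rewrite /sumRV -[in iota 0 n](subn0 n) -/(index_iota 0 n) big_mkord. Qed.

(** * Characteristic functions of sums *)

Section characteristic_functions.
Context d (T : measurableType d) (R : realType) (P : probability T R).
Local Open Scope complex_scope.

Lemma measurable_cosM (t : R) : measurable_fun setT (fun x : R => cos (t * x)).
Proof.
apply: measurableT_comp; last by apply: measurable_funM.
by apply: continuous_measurable_fun; exact: continuous_cos.
Qed.

Lemma measurable_sinM (t : R) : measurable_fun setT (fun x : R => sin (t * x)).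
Proof.
apply: measurableT_comp; last by apply: measurable_funM.
by apply: continuous_measurable_fun; exact: continuous_sin.
Qed.

Let PT : (P setT < +oo)%E. Proof. by rewrite probability_setT ltry. Qed.

Lemma integrable_cos (U : {RV P >-> R}) t :
  P.-integrable setT (EFin \o ((fun x => cos (t * x)) \o U)).
Proof.
apply: (@integrable_bounded _ _ _ P ((fun x => cos (t * x)) \o U) 1) => //.
  exact: (measurableT_comp (measurable_cosM t)).
by move=> x /=; rewrite ler_norml cos_le1 cos_geN1.
Qed.

Lemma integrable_sin (U : {RV P >-> R}) t :
  P.-integrable setT (EFin \o ((fun x => sin (t * x)) \o U)).
Proof.
apply: (@integrable_bounded _ _ _ P ((fun x => sin (t * x)) \o U) 1) => //.
  exact: (measurableT_comp (measurable_sinM t)).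
by move=> x /=; rewrite ler_norml sin_le1 sin_geN1.
Qed.

Definition charfun (U : T -> R) (t : R) : R[i] :=
  (\int[P]_w cos (t * U w)) +i* (\int[P]_w sin (t * U w)).

Lemma cexpectation_expi (Z : T -> R) :
  cexpectation P (fun w => expi (Z w)) = (\int[P]_w cos (Z w)) +i* (\int[P]_w sin (Z w)).
Proof. by rewrite /cexpectation unlock. Qed.

Lemma charfun_same_law (U V : {RV P >-> R}) t :
  (forall A : set R, measurable A -> P (U @^-1` A) = P (V @^-1` A)) ->
  charfun U t = charfun V t.
Proof.
move=> H; have [_ Ec] := integral_same_law H (measurable_cosM t) (integrable_cos V t).
have [_ Es] := integral_same_law H (measurable_sinM t) (integrable_sin V t).
by rewrite /charfun Ec Es.
Qed.

Lemma law_mixture_of_charfunC (U V W : {RV P >-> R}) (rho : R) : 0 <= rho <= 1 ->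
  (forall t, charfun U t = rho%:C * charfun V t + (1 - rho)%:C * charfun W t) ->
  is_law_mixture P U V W rho.
Proof.
move=> rho01 H; apply: law_mixture_of_charfun => // t.
  have := congr1 (@complex.Re R) (H t); rewrite /charfun /= => ->.
  by rewrite !mul0r !subr0.
have := congr1 (@complex.Im R) (H t); rewrite /charfun /= => ->.
by rewrite !mul0r !addr0.
Qed.

Lemma charfun_sumRV_nil (X : nat -> {RV P >-> R}) t : charfun (sumRV X [::]) t = 1.
Proof.
rewrite /charfun; under eq_Rintegral do rewrite /sumRV big_nil mulr0 cos0.
under [X in _ +i* X]eq_Rintegral do rewrite /sumRV big_nil mulr0 sin0.
by rewrite !Rintegral_prob_cst.
Qed.

(** Multiplicativity under independence: the real and imaginary parts are the
    addition formulas for cosine and sine. *)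
Lemma charfun_sumRV (X : nat -> {RV P >-> R}) (X0 : {RV P >-> R}) (J : seq nat) (t : R) :
  iid_copies P (fun j => X j : T -> R) X0 -> uniq J ->
  charfun (sumRV X J) t = charfun X0 t ^+ size J.
Proof.
move=> [indX lawX]; elim: J => [_|j J IH /= /andP[jJ uJ]].
  by rewrite expr0 charfun_sumRV_nil.
rewrite exprS -IH// -(charfun_same_law t (lawX j)).
have ind := independent_sumRV indX jJ uJ.
have ic1 := integrable_cos (X j) t; have ic2 := integrable_cos (sumRV X J) t.
have is1 := integrable_sin (X j) t; have is2 := integrable_sin (sumRV X J) t.
have mc := measurable_cosM t; have ms := measurable_sinM t.
have [icc Ecc] := Rintegral_independent_mul ind mc mc ic1 ic2.
have [iss Ess] := Rintegral_independent_mul ind ms ms is1 is2.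
have [ics Ecs] := Rintegral_independent_mul ind mc ms ic1 is2.
have [isc Esc] := Rintegral_independent_mul ind ms mc is1 ic2.
rewrite {2 3}/charfun; rewrite [RHS]/GRing.mul/= -Ecc -Ess -Ecs -Esc.
rewrite -RintegralB// -RintegralD//; congr (_ +i* _); apply: eq_Rintegral => w _.
  by rewrite /sumRV big_cons mulrDr cosD.
by rewrite /sumRV big_cons mulrDr sinD addrC.
Qed.

Lemma same_law_sumRV (X : nat -> {RV P >-> R}) (X0 : {RV P >-> R}) (J K : seq nat) :
  iid_copies P (fun j => X j : T -> R) X0 -> uniq J -> uniq K -> size J = size K ->
  forall A : set R, measurable A -> P (sumRV X J @^-1` A) = P (sumRV X K @^-1` A).
Proof.
move=> iidX uJ uK JK; apply/same_law_mixtureP; apply: law_mixture_of_charfunC.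
  by rewrite lexx ler01.
by move=> t; rewrite subrr mul0r addr0 mul1r !(charfun_sumRV _ iidX)// JK.
Qed.

(** Exchangeability under the transposition of 0 and j, on an event that
    constrains one coordinate. *)
Lemma exchangeable_same_law (X : nat -> {RV P >-> R}) (j : nat) :
  exchangeable P (fun k => X k : T -> R) ->
  forall A : set R, measurable A -> P (X j @^-1` A) = P (X 0%N @^-1` A).
Proof.
move=> exX A mA.
pose B := [set x : j.+1.-tuple R | A (tnth x ord0)].
have mB : measurable B.
  by rewrite -[B]setTI; exact: (@measurable_tnth _ R j.+1 ord0 measurableT A mA).
have := exX j.+1 (tperm ord0 ord_max) B mB.
rewrite /B; under eq_set do rewrite /= tnth_mktuple tpermL.
by under [X in _ = P X -> _]eq_set do rewrite /= tnth_mktuple.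
Qed.

(** With all t_j equal to t, the model says that the characteristic function of
    X_1 + ... + X_n is the mixture of those of n X_1 and of a sum of n
    independent copies of X_1. Only these one-dimensional laws enter the
    estimate of a random sum. *)
Lemma equally_correlated_law (X X' : nat -> {RV P >-> R}) (rho : R) (n : nat) :
  0 <= rho <= 1 ->
  (forall j, forall A : set R, measurable A -> P (X j @^-1` A) = P (X 0%N @^-1` A)) ->
  equally_correlated P (fun k => X k : T -> R) rho ->
  iid_copies P (fun j => X' j : T -> R) (X 0%N) ->
  is_law_mixture P (sumRV X (iota 0 n)) (sumRV (fun=> X 0%N) (iota 0 n))
    (sumRV X' (iota 0 n)) rho.
Proof.
move=> rho01 lawX corr iidX'; apply: law_mixture_of_charfunC => // t.
rewrite (charfun_sumRV _ iidX') ?iota_uniq// size_iota.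
case: n => [|n].
  by rewrite !charfun_sumRV_nil expr0 !mulr1 -rmorphD/= addrC subrK.
have := corr n.+1 (fun=> t) isT.
rewrite !cexpectation_expi.
rewrite (eq_bigr (fun=> charfun (X 0%N) t)); last first.
  by move=> j _; rewrite cexpectation_expi -(charfun_same_law t (lawX j)).
rewrite prodr_const card_ord.
have E1 w : \sum_(j < n.+1) t * X j w = t * sumRV X (iota 0 n.+1) w.
  by rewrite sumRV_iota mulr_sumr.
have E2 w : X 0%N w * \sum_(j < n.+1) t = t * sumRV (fun=> X 0%N) (iota 0 n.+1) w.
  by rewrite sumRV_iota !sumr_const !card_ord !mulrnAr mulrC.
under eq_Rintegral do rewrite E1.
under [X in _ +i* X]eq_Rintegral do rewrite E1.
under [X in _ = _ * (X +i* _) + _ -> _]eq_Rintegral do rewrite E2.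
under [X in _ = _ * (_ +i* X) + _ -> _]eq_Rintegral do rewrite E2.
by [].
Qed.
End characteristic_functions.

(** * Taylor expansions under a Lipschitz derivative *)

(** The second order remainder of a function whose derivative is 2-Lipschitz:
    x^2 is the primitive of 2 x, which bounds the increments of g. Negative
    increments are reduced to positive ones by reflection. *)
Lemma taylor_lipschitz_derivative (R : realType) (f g : R -> R) (y x : R) :
  (forall z, is_derive z (1 : R) f (g z)) ->
  (forall u v, `|g v - g u| <= 2 * `|v - u|) ->
  `|f (y + x) - f y - x * g y| <= x ^+ 2.
Proof.
wlog x0 : f g y x / 0 <= x => [wl df gL|df gL].
  have [x0|x0] := leP 0 x; first exact: wl.
  have dfN z : is_derive z (1 : R) (fun z => - f (- z)) (g (- z)).
    have D := is_derive1_comp (df (- z)) (is_deriveN (is_derive_id z (1 : R))).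
    by apply: (is_derive_eq (is_deriveN D)); ring.
  have gLN u v : `|g (- v) - g (- u)| <= 2 * `|v - u|.
    by rewrite (le_trans (gL _ _))// ler_wpM2l// -opprB normrN opprK addrC.
  have xN0 : 0 <= - x by rewrite oppr_ge0 ltW.
  have := wl _ _ (- y) (- x) xN0 dfN gLN.
  rewrite !opprK sqrrN -opprD opprK.
  by rewrite (_ : - f (y + x) + f y - - x * g y = - (f (y + x) - f y - x * g y)) ?normrN//; ring.
have yx : y <= y + x by rewrite lerDl.
have dsq z : is_derive z (1 : R) (fun z => (z - y) ^+ 2) (2 * (z - y)).
  have D := is_deriveB (is_derive_id z (1 : R)) (is_derive_cst y z (1 : R)).
  by apply: (is_derive_eq (is_deriveX 2 D)); rewrite /GRing.scale/= expr1 subr0 mulr1.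
have dlin z : is_derive z (1 : R) (fun z => g y * z) (g y).
  by apply: (is_derive_eq (is_deriveZ (g y) (is_derive_id z (1 : R)))); rewrite /GRing.scale/= mulr1.
have gB z : y <= z -> - (2 * (z - y)) <= g z - g y <= 2 * (z - y).
  by move=> yz; rewrite -ler_norml (le_trans (gL _ _))// ger0_norm// subr_ge0.
have up := le_of_derive_ge0 yx
  (fun z _ => is_deriveD (dsq z) (is_deriveB (df z) (dlin z))).
have dn := le_of_derive_ge0 yx
  (fun z _ => is_deriveB (dsq z) (is_deriveB (df z) (dlin z))).
have {}up : (y - y) ^+ 2 + (f y - g y * y) <=
    (y + x - y) ^+ 2 + (f (y + x) - g y * (y + x)).
  by apply: up => z /andP[yz _]; have := gB z yz; lra.
have {}dn : (y - y) ^+ 2 - (f y - g y * y) <=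
    (y + x - y) ^+ 2 - (f (y + x) - g y * (y + x)).
  by apply: dn => z /andP[yz _]; have := gB z yz; lra.
have eyx : y + x - y = x by ring.
rewrite eyx subrr expr0n /= add0r in up.
rewrite eyx subrr expr0n /= sub0r in dn.
by rewrite ler_norml; apply/andP; split; lra.
Qed.

Section stein_moments.
Context d (T : measurableType d) (R : realType) (P : probability T R).

Lemma Rintegral_error_le (u v e : T -> R) :
  measurable_fun setT u ->
  P.-integrable setT (EFin \o v) -> P.-integrable setT (EFin \o e) ->
  (forall w, `|u w - v w| <= e w) ->
  P.-integrable setT (EFin \o u) /\ `|\int[P]_w u w - \int[P]_w v w| <= \int[P]_w e w.
Proof.
move=> mu iv ie uve.
have iu : P.-integrable setT (EFin \o u).
  have := integrableD measurableT (integrable_norm iv) ie.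
  apply: le_integrable => //; first exact/measurable_EFinP.
  move=> w _ /=; rewrite lee_fin [leRHS]ger0_norm.
    have -> : u w = v w + (u w - v w) by ring.
    by apply: (le_trans (ler_normD _ _)); rewrite lerD2l.
  by rewrite addr_ge0// (le_trans _ (uve w)).
split => //; rewrite -RintegralB//.
have iuv : P.-integrable setT (EFin \o (fun w => u w - v w)).
  by have := integrableB measurableT iu iv; apply: eq_integrable.
apply: (le_trans (le_normr_Rintegral measurableT iuv)).
by apply: le_Rintegral => //; exact: (integrable_norm iuv).
Qed.

Variables (f g : R -> R) (s : R).
Hypotheses (s0 : 0 <= s) (df : forall z, is_derive z (1 : R) f (g z)).
Hypotheses (gL : forall u v, `|g v - g u| <= 2 * `|v - u|).

Lemma measurable_stein_f : measurable_fun setT f.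
Proof.
apply: continuous_measurable_fun => x; apply: differentiable_continuous.
by apply/derivable1_diffP; case: (df x).
Qed.

Lemma measurable_stein_g : measurable_fun setT g.
Proof.
apply: continuous_measurable_fun => x; apply/cvgrPdist_le => e e0; near=> t.
apply: (le_trans (gL _ _)).
suff : `|x - t| <= e / 2 by lra.
near: t; rewrite /prop_near1; exists (e / 2) => /=; first by rewrite divr_gt0.
by move=> t /ltW.
Unshelve. all: by end_near. Qed.

Lemma stein_g_growth z : `|g z| <= `|g 0| + 2 * `|z|.
Proof.
rewrite -[g z](subrK (g 0)) addrC (le_trans (ler_normD _ _))// lerD2l.
by rewrite (le_trans (gL 0 z))// subr0.
Qed.

(** The expansion used for a centred summand x independent of the remaining sum
    y: the term linear in x has mean zero, the quadratic one produces the
    variance of x and the derivative of f at y. *)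
Lemma taylor_scaled (x y : R) :
  `|x * f (s * (x + y)) - (f (s * y) * x + s * (x ^+ 2 * g (s * y)))| <= s ^+ 2 * `|x| ^+ 3.
Proof.
have := @taylor_lipschitz_derivative R f g (s * y) (s * x) df gL.
rewrite (_ : s * y + s * x = s * (x + y)); last by ring.
move=> H.
rewrite (_ : _ - _ = x * (f (s * (x + y)) - f (s * y) - s * x * g (s * y))); last by ring.
rewrite normrM (_ : s ^+ 2 * `|x| ^+ 3 = `|x| * (s * x) ^+ 2) ?ler_wpM2l//.
by rewrite -[(s * x) ^+ 2]real_normK ?num_real// normrM (ger0_norm s0); ring.
Qed.

End stein_moments.

(** * Stein errors of dependent and independent sums *)

Lemma Rintegral_sum d (T : measurableType d) (R : realType) (mu : {measure set T -> \bar R})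
    (I : eqType) (J : seq I) (h : I -> T -> R) :
  (forall i, i \in J -> mu.-integrable setT (EFin \o h i)) ->
  mu.-integrable setT (fun w => (\sum_(i <- J) h i w)%:E) /\
  \int[mu]_w (\sum_(i <- J) h i w) = \sum_(i <- J) \int[mu]_w h i w.
Proof.
elim: J => [_|j J IH ih].
  split.
    by under eq_fun do rewrite big_nil; exact: integrable0.
  rewrite big_nil; under eq_Rintegral do rewrite big_nil.
  by rewrite /Rintegral integral0.
have ij : mu.-integrable setT (EFin \o h j) by apply: ih; exact: mem_head.
have [|iJ EJ] := IH; first by move=> i iJ; apply: ih; rewrite in_cons iJ orbT.
split.
  have := integrableD measurableT ij iJ; apply: eq_integrable => // w _.
  by rewrite big_cons.
by rewrite big_cons -EJ -RintegralD//; apply: eq_Rintegral => w _; rewrite big_cons.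
Qed.

Section third_moment.
Context d (T : measurableType d) (R : realType) (P : probability T R).
Variable X0 : {RV P >-> R}.
Hypothesis iX3 : P.-integrable setT (EFin \o ((fun x => `|x| ^+ 3) \o X0)).
Hypothesis X0mean : \int[P]_w X0 w = 0.

Let m2 := \int[P]_w (X0 w ^+ 2).
Let m3 := \int[P]_w (`|X0 w| ^+ 3).

Let mid : measurable_fun setT (idfun : R -> R). Proof. exact: measurable_id. Qed.

Let iX_le (a : R -> R) : measurable_fun setT a -> (forall x, `|a x| <= 1 + `|x| ^+ 3) ->
  P.-integrable setT (EFin \o (a \o X0)).
Proof.
move=> ma aX.
have i1 : P.-integrable setT (EFin \o cst (1 : R)) by exact: finite_measure_integrable_cst.
have := integrableD measurableT i1 iX3; apply: le_integrable => //.
  by apply/measurable_EFinP; exact: (measurableT_comp ma).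
move=> w _ /=; rewrite lee_fin [leRHS]ger0_norm; last by rewrite addr_ge0.
exact: aX.
Qed.

Lemma integrable_third_moment1 : P.-integrable setT (EFin \o X0).
Proof.
apply: (iX_le mid) => x /=.
have x0 := normr_ge0 x; have [x1|x1] := leP `|x| 1.
  by rewrite (le_trans x1)// lerDl exprn_ge0.
have : `|x| <= `|x| ^+ 3 by rewrite -[leLHS]expr1 ler_eXn2l// ltW.
by lra.
Qed.

Lemma integrable_third_moment2 : P.-integrable setT (EFin \o ((fun x => x ^+ 2) \o X0)).
Proof.
apply: iX_le => // x; rewrite normrX.
have x0 := normr_ge0 x; have [x1|x1] := leP `|x| 1.
  by rewrite (le_trans (exprn_ile1 2 x0 x1))// lerDl exprn_ge0.
have : `|x| ^+ 2 <= `|x| ^+ 3 by rewrite ler_eXn2l// ltW.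
by lra.
Qed.

Let iX1 := integrable_third_moment1.
Let iX2 := integrable_third_moment2.

Variable X' : nat -> {RV P >-> R}.
Hypothesis iidX' : iid_copies P (fun j => X' j : T -> R) X0.

Let lawX' j : forall A : set R, measurable A -> P (X' j @^-1` A) = P (X0 @^-1` A).
Proof. exact: iidX'.2. Qed.

Let moment (a : R -> R) j : measurable_fun setT a -> P.-integrable setT (EFin \o (a \o X0)) ->
  P.-integrable setT (EFin \o (a \o X' j)) /\ \int[P]_w a (X' j w) = \int[P]_w a (X0 w).
Proof. by move=> ma ia; exact: (integral_same_law (lawX' j) ma ia). Qed.

Lemma integrable_sumRV (X : nat -> {RV P >-> R}) J :
  (forall j, P.-integrable setT (EFin \o X j)) -> P.-integrable setT (EFin \o sumRV X J).
Proof. by move=> iX; have [] := @Rintegral_sum _ _ _ P nat J (fun j => X j) (fun j _ => iX j). Qed.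

Let iX'1 j : P.-integrable setT (EFin \o X' j).
Proof. by have [] := moment j mid iX1. Qed.

Lemma Rintegral_sumRV_iid J : \int[P]_w sumRV X' J w = 0.
Proof.
have [_ ->] := @Rintegral_sum _ _ _ P nat J (fun j => X' j) (fun j _ => iX'1 j).
rewrite big1// => j _.
by have [_ ->] := moment j mid iX1.
Qed.

Lemma second_moment_sumRV_iid J : uniq J ->
  P.-integrable setT (EFin \o ((fun x => x ^+ 2) \o sumRV X' J)) /\
  \int[P]_w (sumRV X' J w ^+ 2) = (size J)%:R * m2.
Proof.
elim: J => [_|j J IH /= /andP[jJ uJ]].
  have E w : sumRV X' [::] w ^+ 2 = 0 by rewrite /sumRV big_nil expr0n.
  split.
    rewrite (_ : EFin \o _ = cst 0%E); first exact: integrable0.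
    by apply/funext => w /=; rewrite E.
  by under eq_Rintegral do rewrite E; rewrite Rintegral_prob_cst mul0r.
have [iS ES] := IH uJ.
have [ij Ej] := moment j (exprn_measurable 2) iX2.
have iS1 := integrable_sumRV J iX'1.
have [iP EP] := Rintegral_independent_mul (a := idfun) (b := idfun)
  (independent_sumRV iidX'.1 jJ uJ) mid mid (iX'1 j) iS1.
have iP2 : P.-integrable setT (EFin \o (fun w => 2 * (X' j w * sumRV X' J w))).
  by have := integrableZl measurableT 2 iP; apply: eq_integrable.
have iS2 : P.-integrable setT (EFin \o (fun w => 2 * (X' j w * sumRV X' J w) + sumRV X' J w ^+ 2)).
  by have := integrableD measurableT iP2 iS; apply: eq_integrable.
have E w : sumRV X' (j :: J) w ^+ 2 =
    X' j w ^+ 2 + (2 * (X' j w * sumRV X' J w) + sumRV X' J w ^+ 2).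
  by rewrite /sumRV big_cons; ring.
split.
  have := integrableD measurableT ij iS2; apply: eq_integrable => // w _ /=.
  by rewrite E.
under eq_Rintegral do rewrite E.
rewrite RintegralD// RintegralD// RintegralZl// EP Rintegral_sumRV_iid mulr0 mulr0 add0r.
by rewrite Ej ES -/m2 -[(size J).+1]add1n natrD mulrDl mul1r.
Qed.

Variables (f g : R -> R) (s : R).
Hypotheses (s0 : 0 <= s) (df : forall z, is_derive z (1 : R) f (g z)).
Hypotheses (gL : forall u v, `|g v - g u| <= 2 * `|v - u|) (f1 : forall z, `|f z| <= 1).

Let mf := measurable_stein_f df.
Let mg := measurable_stein_g gL.

Let mfs : measurable_fun setT (fun x => f (s * x)).
Proof. by apply: measurableT_comp => //; apply: measurable_funM. Qed.
Let mgs : measurable_fun setT (fun x => g (s * x)).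
Proof. by apply: measurableT_comp => //; apply: measurable_funM. Qed.

Lemma integrable_stein_f (U : {RV P >-> R}) :
  P.-integrable setT (EFin \o ((fun x => f (s * x)) \o U)).
Proof.
have PT : (P setT < +oo)%E by rewrite probability_setT ltry.
apply: (@integrable_bounded _ _ _ P ((fun x => f (s * x)) \o U) 1 PT).
- exact: (measurableT_comp mfs).
- by move=> w; exact: f1.
Qed.

Lemma integrable_stein_g (U : {RV P >-> R}) : P.-integrable setT (EFin \o U) ->
  P.-integrable setT (EFin \o ((fun x => g (s * x)) \o U)).
Proof.
move=> iU.
have i1 : P.-integrable setT (EFin \o cst `|g 0|) by exact: finite_measure_integrable_cst.
have i2 := integrableZl measurableT (2 * s) (integrable_norm iU).
have := integrableD measurableT i1 i2; apply: le_integrable => //.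
  by apply/measurable_EFinP; exact: (measurableT_comp mgs).
move=> w _ /=; rewrite lee_fin [leRHS]ger0_norm; last first.
  by rewrite addr_ge0// mulr_ge0// mulr_ge0.
by rewrite (le_trans (stein_g_growth gL _))// lerD2l normrM (ger0_norm s0) mulrA.
Qed.

(** Extreme dependence: c X0 is expanded around 0, since there is no independent
    part left. *)
Lemma stein_error_multiple (c : R) : 0 <= c ->
  P.-integrable setT (EFin \o (fun w => c * X0 w * f (s * (c * X0 w)))) /\
  `|\int[P]_w (c * X0 w * f (s * (c * X0 w))) - s * m2 * (c ^+ 2 * g 0)| <=
  s ^+ 2 * m3 * c ^+ 3.
Proof.
move=> c0.
pose v w := f 0 * c * X0 w + s * c ^+ 2 * g 0 * X0 w ^+ 2.
pose e w := s ^+ 2 * c ^+ 3 * `|X0 w| ^+ 3.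
have i1 : P.-integrable setT (EFin \o (fun w => f 0 * c * X0 w)).
  by have := integrableZl measurableT (f 0 * c) iX1; apply: eq_integrable.
have i2 : P.-integrable setT (EFin \o (fun w => s * c ^+ 2 * g 0 * X0 w ^+ 2)).
  by have := integrableZl measurableT (s * c ^+ 2 * g 0) iX2; apply: eq_integrable.
have iv : P.-integrable setT (EFin \o v).
  by have := integrableD measurableT i1 i2; apply: eq_integrable.
have ie : P.-integrable setT (EFin \o e).
  by have := integrableZl measurableT (s ^+ 2 * c ^+ 3) iX3; apply: eq_integrable.
have mu : measurable_fun setT (fun w => c * X0 w * f (s * (c * X0 w))).
  have mc : measurable_fun setT (fun w => c * X0 w) by exact: measurable_funM.
  by apply: measurable_funM => //; exact: (measurableT_comp mfs mc).
have [w|iu] := Rintegral_error_le mu iv ie.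
  have := taylor_scaled s0 df gL (c * X0 w) 0.
  rewrite addr0 mulr0 /v /e normrM (ger0_norm c0) => /le_trans H.
  by rewrite (_ : _ - _ = c * X0 w * f (s * (c * X0 w)) - (f 0 * (c * X0 w) +
     s * ((c * X0 w) ^+ 2 * g 0))); [apply: H; rewrite exprMn; lra | ring].
rewrite RintegralD// !RintegralZl// X0mean mulr0 add0r -/m2 -/m3 => H.
split => //; rewrite (_ : s * m2 * (c ^+ 2 * g 0) = s * c ^+ 2 * g 0 * m2); last by ring.
by apply: (le_trans H); rewrite mulrAC.
Qed.

(** Independence: every summand is expanded around the sum of the others, which
    is independent of it and has the law of a sum of size J - 1 copies. *)
Lemma stein_error_iid_sum (J : seq nat) : uniq J ->
  P.-integrable setT (EFin \o (fun w => sumRV X' J w * f (s * sumRV X' J w))) /\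
  `|\int[P]_w (sumRV X' J w * f (s * sumRV X' J w)) -
    s * m2 * ((size J)%:R * \int[P]_w g (s * sumRV X' (iota 0 (size J).-1) w))| <=
  s ^+ 2 * m3 * (size J)%:R.
Proof.
move=> uJ; set S := sumRV X' J; pose k := \int[P]_w g (s * sumRV X' (iota 0 (size J).-1) w).
have term j : j \in J -> P.-integrable setT (EFin \o (fun w => X' j w * f (s * S w))) /\
    `|\int[P]_w (X' j w * f (s * S w)) - s * m2 * k| <= s ^+ 2 * m3.
  move=> jJ; set S' := sumRV X' (rem j J).
  have SE w : S w = X' j w + S' w by rewrite /S /S' /sumRV (big_rem j).
  have uJ' : uniq (rem j J) by exact: rem_uniq.
  have jJ' : j \notin rem j J by rewrite mem_rem_uniqF.
  have ind := independent_sumRV iidX'.1 jJ' uJ'.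
  have iS' : P.-integrable setT (EFin \o S') by exact: integrable_sumRV.
  have [ij2 Ej2] := moment j (exprn_measurable 2) iX2.
  have m3fun : measurable_fun setT (fun x : R => `|x| ^+ 3).
    exact: (measurableT_comp (exprn_measurable 3)).
  have [ij3 Ej3] := moment j m3fun iX3.
  have [ia Ea] := Rintegral_independent_mul (a := idfun) (b := fun x => f (s * x)) ind
    mid mfs (iX'1 j) (integrable_stein_f _).
  have [ib Eb] := Rintegral_independent_mul (a := fun x => x ^+ 2) (b := fun x => g (s * x)) ind
    (exprn_measurable 2) mgs ij2 (integrable_stein_g iS').
  have szJ : size (rem j J) = size (iota 0 (size J).-1) by rewrite size_iota size_rem.
  have [_ Ek] := integral_same_law
    (same_law_sumRV iidX' uJ' (iota_uniq 0 (size J).-1) szJ) mgs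
    (integrable_stein_g (integrable_sumRV (iota 0 (size J).-1) iX'1)).
  pose v w := X' j w * f (s * S' w) + s * (X' j w ^+ 2 * g (s * S' w)).
  pose e w := s ^+ 2 * `|X' j w| ^+ 3.
  have ibs : P.-integrable setT (EFin \o (fun w => s * (X' j w ^+ 2 * g (s * S' w)))).
    by have := integrableZl measurableT s ib; apply: eq_integrable.
  have iv : P.-integrable setT (EFin \o v).
    by have := integrableD measurableT ia ibs; apply: eq_integrable.
  have ie : P.-integrable setT (EFin \o e).
    by have := integrableZl measurableT (s ^+ 2) ij3; apply: eq_integrable.
  have mu : measurable_fun setT (fun w => X' j w * f (s * S w)).
    by apply: measurable_funM => //; exact: (measurableT_comp mfs).
  have [w|iu H] := Rintegral_error_le mu iv ie.
    have := taylor_scaled s0 df gL (X' j w) (S' w).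
    by rewrite -SE /v /e [f (s * S' w) * _]mulrC.
  split => //; move: H; rewrite RintegralD// !RintegralZl//.
  rewrite [X in `|_ - (X + _)|]Ea [X in `|_ - (_ + _ * X)|]Eb Ek Ej3 Ej2 -/m2 -/m3.
  have [_ Ej1] := moment j mid iX1.
  by rewrite Ej1 X0mean mul0r add0r mulrA.
have sumc (c : R) : \sum_(j <- J) c = (size J)%:R * c.
  by rewrite big_const_seq count_predT iter_addr_0 mulr_natl.
have E w : S w * f (s * S w) = \sum_(j <- J) X' j w * f (s * S w).
  by rewrite {1}/S /sumRV mulr_suml.
have [iS ES] := Rintegral_sum (fun j jJ => (term j jJ).1).
split.
  by move: iS; apply: eq_integrable => // w _ /=; rewrite E.
under eq_Rintegral do rewrite E.
rewrite ES (_ : s * m2 * _ = \sum_(j <- J) s * m2 * k); last first.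
  by rewrite sumc -/k mulrCA.
rewrite -sumrB (le_trans (ler_norm_sum _ _ _))//.
rewrite (_ : s ^+ 2 * m3 * _ = \sum_(j <- J) s ^+ 2 * m3); last first.
  by rewrite sumc mulrC.
rewrite big_seq [leRHS]big_seq; apply: ler_sum => j jJ.
exact: (term j jJ).2.
Qed.
End third_moment.

(** * Random sums and size bias *)

Lemma integrable_nat_pow_le d (T : measurableType d) (R : realType) (P : probability T R)
    (M : {RV P >-> nat}) (c : nat -> R) (a b : R) (k : nat) :
  P.-integrable setT (fun w => ((M w)%:R ^+ k)%:E) ->
  (forall n, `|c n| <= a + b * n%:R ^+ k) ->
  P.-integrable setT (fun w => (c (M w))%:E).
Proof.
move=> iM cM.
have i1 : P.-integrable setT (EFin \o cst a) by exact: finite_measure_integrable_cst.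
have i2 := integrableZl measurableT b iM.
have := integrableD measurableT i1 i2; apply: le_integrable => //.
  by apply/measurable_EFinP; exact: (measurableT_comp (f := c)).
by move=> w _ /=; rewrite lee_fin (le_trans (cM _))// ler_norm.
Qed.

Lemma integrable_nat_pow d (T : measurableType d) (R : realType) (P : probability T R)
    (N : {RV P >-> nat}) (m k : nat) : (k <= m)%N ->
  P.-integrable setT (fun w => ((N w)%:R ^+ m)%:E : \bar R) ->
  P.-integrable setT (fun w => ((N w)%:R ^+ k)%:E : \bar R).
Proof.
move=> km iN; apply: (integrable_nat_pow_le (c := fun n => n%:R ^+ k) (a := 1) (b := 1) iN) => n.
rewrite ger0_norm ?exprn_ge0// mul1r; case: n => [|n].
  by rewrite !expr0n; apply: ler_wpDr; case: k km => [|k] _ /=; rewrite ?ler0n ?ler01.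
rewrite -[leLHS]add0r lerD// ler_weXn2l//.
by rewrite ler1n.
Qed.

Section random_sums.
Context d (T : measurableType d) (R : realType) (P : probability T R).
Variables (N Ns : {RV P >-> nat}) (X X' : nat -> {RV P >-> R}) (rho : R).
Hypothesis rho01 : 0 <= rho <= 1.
Hypothesis iN3 : P.-integrable setT (fun w => ((N w)%:R ^+ 3)%:E).
Hypothesis iX3 : P.-integrable setT (EFin \o ((fun x => `|x| ^+ 3) \o X 0%N)).
Hypothesis X0mean : \int[P]_w X 0%N w = 0.
Hypothesis lawX : forall j, forall A : set R, measurable A ->
  P (X j @^-1` A) = P (X 0%N @^-1` A).
Hypothesis corr : equally_correlated P (fun k => X k : T -> R) rho.
Hypothesis iidX' : iid_copies P (fun j => X' j : T -> R) (X 0%N).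

Let family (i : nat + nat) : T -> R := match i with inl k => X k | inr j => X' j end.

Hypothesis indep : independent_systems P
  (g_sigma_algebra_preimage (fun w => (N w, Ns w))) (sigma_family family).
Hypothesis biased : size_biased P (fun w => (N w)%:R : R) (fun w => (Ns w)%:R).

Let S : set (set T) := \bigcup_(i in [set: nat + nat]) g_sigma_algebra_preimage (family i).

Let S_measurable : S `<=` measurable.
Proof.
by move=> _ [[k|k] _ [B mB <-]]; rewrite setTI; exact: measurable_funPTI.
Qed.

Let indepN A B : <<s S >> B -> P (N @^-1` A `&` B) = (P (N @^-1` A) * P B)%E.
Proof.
move=> SB; apply: indep => //; exists (A `*` setT); first exact: measurableX.
by rewrite setTI; apply/seteqP; split => w //= [].
Qed.

Let indepNs A B : <<s S >> B -> P (Ns @^-1` A `&` B) = (P (Ns @^-1` A) * P B)%E.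
Proof.
move=> SB; apply: indep => //; exists (setT `*` A); first exact: measurableX.
by rewrite setTI; apply/seteqP; split => w //= [].
Qed.

Let measurable_familyX k : measurable_fun setT (X k : g_sigma_algebraType S -> R).
Proof.
move=> _ B mB; rewrite setTI; apply: sub_sigma_algebra.
by exists (inl k) => //; exists B => //; rewrite setTI.
Qed.

Let measurable_familyX' k : measurable_fun setT (X' k : g_sigma_algebraType S -> R).
Proof.
move=> _ B mB; rewrite setTI; apply: sub_sigma_algebra.
by exists (inr k) => //; exists B => //; rewrite setTI.
Qed.

(** Freezing of an independent index M in a sum of members of the family. The
    bound c on the conditional absolute means provides integrability. *)
Let at_index (M : {RV P >-> nat}) (Z : nat -> {RV P >-> R}) (J : nat -> seq nat)
    (a : R -> R) (c : nat -> R) :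
  (forall A B, <<s S >> B -> P (M @^-1` A `&` B) = (P (M @^-1` A) * P B)%E) ->
  (forall k, measurable_fun setT (Z k : g_sigma_algebraType S -> R)) ->
  measurable_fun setT a ->
  (forall n, P.-integrable setT (EFin \o (a \o sumRV Z (J n)))) ->
  (forall n, \int[P]_w `|a (sumRV Z (J n) w)| <= c n) ->
  P.-integrable setT (fun w => (c (M w))%:E) ->
  P.-integrable setT (fun w => (a (sumRV Z (J (M w)) w))%:E) /\
  \int[P]_w a (sumRV Z (J (M w)) w) = \int[P]_w \int[P]_v a (sumRV Z (J (M w)) v).
Proof.
move=> indM mZ ma iZ cZ ic.
apply: (Rintegral_random_index (G := fun n w => a (sumRV Z (J n) w)) S_measurable indM) => //.
  move=> n; apply: (measurableT_comp ma).
  exact: (@measurable_sum _ (g_sigma_algebraType S) R setT nat (J n) (fun k => Z k) mZ).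
move: ic; apply: le_integrable => //.
  apply/measurable_EFinP.
  exact: (measurableT_comp (f := fun n => \int[P]_v `|a (sumRV Z (J n) v)|)).
move=> w _ /=; rewrite lee_fin ger0_norm; last by apply: Rintegral_ge0.
by rewrite (le_trans (cZ _))// ler_norm.
Qed.

Let m1 := \int[P]_w `|X 0%N w|.
Let m2 := \int[P]_w (X 0%N w ^+ 2).
Let m3 := \int[P]_w (`|X 0%N w| ^+ 3).

Let iX1 := integrable_third_moment1 iX3.
Let iX2 := integrable_third_moment2 iX3.

Let mid : measurable_fun setT (idfun : R -> R). Proof. exact: measurable_id. Qed.
Let mnorm : measurable_fun setT (fun x : R => `|x|). Proof. exact: measurableT_comp. Qed.

Let iXk k : P.-integrable setT (EFin \o X k).
Proof. by have [] := integral_same_law (lawX k) mid iX1. Qed.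

Let iX'k k : P.-integrable setT (EFin \o X' k).
Proof. by have [] := integral_same_law (iidX'.2 k) mid iX1. Qed.

Let abs_sum_le (Z : nat -> {RV P >-> R}) (J : seq nat) :
  (forall k, P.-integrable setT (EFin \o Z k)) ->
  (forall k, forall A : set R, measurable A -> P (Z k @^-1` A) = P (X 0%N @^-1` A)) ->
  \int[P]_w `|sumRV Z J w| <= (size J)%:R * m1.
Proof.
move=> iZ lawZ.
have iZn k : P.-integrable setT (EFin \o (fun w => `|Z k w|)) by exact: (integrable_norm (iZ k)).
have [isum E] := @Rintegral_sum _ _ _ P nat J (fun k w => `|Z k w|) (fun k _ => iZn k).
have -> : (size J)%:R * m1 = \int[P]_w (\sum_(k <- J) `|Z k w|).
  rewrite E (eq_bigr (fun=> m1)) => [|k _].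
    by rewrite big_const_seq count_predT iter_addr_0 mulr_natl.
  by have [_ ->] := integral_same_law (lawZ k) mnorm (integrable_norm iX1).
apply: le_Rintegral => //.
  exact: (integrable_norm (integrable_sumRV J iZ)).
by move=> w _; exact: ler_norm_sum.
Qed.

Let constant_sum n w : sumRV (fun=> X 0%N) (iota 0 n) w = n%:R * X 0%N w.
Proof. by rewrite sumRV_iota sumr_const card_ord mulr_natl. Qed.

Let law_sum n := equally_correlated_law n rho01 lawX corr iidX'.

(** By the mixture representation, n^2 m2 with weight rho and n m2 with weight
    1 - rho. *)
Lemma second_moment_sumRV n :
  P.-integrable setT (EFin \o ((fun x => x ^+ 2) \o sumRV X (iota 0 n))) /\
  \int[P]_w (sumRV X (iota 0 n) w ^+ 2) = (rho * n%:R ^+ 2 + (1 - rho) * n%:R) * m2.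
Proof.
have [iW EW] := second_moment_sumRV_iid iX3 X0mean iidX' (iota_uniq 0 n).
have iV : P.-integrable setT
    (EFin \o ((fun x => x ^+ 2) \o sumRV (fun=> X 0%N) (iota 0 n))).
  have := integrableZl measurableT (n%:R ^+ 2) iX2; apply: eq_integrable => // w _.
  by rewrite /= constant_sum exprMn.
have EV : \int[P]_w (sumRV (fun=> X 0%N) (iota 0 n) w ^+ 2) = n%:R ^+ 2 * m2.
  rewrite -RintegralZl//; apply: eq_Rintegral => w _.
  by rewrite constant_sum exprMn.
have [iU EU] := integral_law_mixture rho01 (law_sum n) (exprn_measurable 2) iV iW.
split => //; rewrite [LHS]EU [X in _ * X + _]EV [X in _ + _ * X]EW size_iota.
by rewrite -/m2; ring.
Qed.

Lemma mean_sumRV n : \int[P]_w sumRV X (iota 0 n) w = 0.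
Proof.
have [_ ->] := @Rintegral_sum _ _ _ P nat (iota 0 n) (fun j => X j) (fun j _ => iXk j).
rewrite big1// => j _.
by have [_ ->] := integral_same_law (lawX j) mid iX1.
Qed.

Let iN k (k3 : (k <= 3)%N) := integrable_nat_pow k3 iN3.

Let EN := \int[P]_w ((N w)%:R : R).
Let EN2 := \int[P]_w ((N w)%:R ^+ 2 : R).
Let EN3 := \int[P]_w ((N w)%:R ^+ 3 : R).

Let iN1 : P.-integrable setT (fun w => ((N w)%:R)%:E : \bar R).
Proof. exact: (iN (isT : (1 <= 3)%N)). Qed.
Let iN2 := iN (isT : (2 <= 3)%N).

Lemma Rintegral_nat_comb (a b c : R) :
  P.-integrable setT (fun w => (a * (N w)%:R ^+ 3 + b * (N w)%:R ^+ 2 + c * (N w)%:R)%:E) /\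
  \int[P]_w (a * (N w)%:R ^+ 3 + b * (N w)%:R ^+ 2 + c * (N w)%:R) =
  a * EN3 + b * EN2 + c * EN.
Proof.
have i3 := integrableZl measurableT a iN3.
have i2 := integrableZl measurableT b iN2.
have i1 := integrableZl measurableT c iN1.
have i32 : P.-integrable setT (EFin \o (fun w => a * (N w)%:R ^+ 3 + b * (N w)%:R ^+ 2)).
  by have := integrableD measurableT i3 i2; apply: eq_integrable.
split; first by have := integrableD measurableT i32 i1; apply: eq_integrable.
by rewrite RintegralD// RintegralD// !RintegralZl.
Qed.

Let Y := random_sum N (fun k => X k : T -> R).

Let YE w : Y w = sumRV X (iota 0 (N w)) w.
Proof. by rewrite sumRV_iota. Qed.

Let m1_ge0 : 0 <= m1. Proof. by apply: Rintegral_ge0. Qed.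

Lemma integrable_random_sum : P.-integrable setT (EFin \o Y) /\ \int[P]_w Y w = 0.
Proof.
have [|||iY EY] := at_index (J := iota 0) (c := fun n => n%:R * m1) indepN
  measurable_familyX mid.
- by move=> n; exact: integrable_sumRV.
- by move=> n; rewrite -[X in X%:R * _](size_iota 0 n); exact: abs_sum_le.
- by have := integrableZr measurableT m1 iN1; apply: eq_integrable.
split; first by move: iY; apply: eq_integrable => // w _; rewrite /= YE.
under eq_Rintegral do rewrite YE.
rewrite [LHS]EY (_ : (fun w => _) = cst 0); first exact: Rintegral_prob_cst.
by apply/funext => w; exact: mean_sumRV.
Qed.

Lemma second_moment_random_sum :
  P.-integrable setT (EFin \o (fun w => Y w ^+ 2)) /\
  \int[P]_w (Y w ^+ 2) = m2 * (rho * EN2 + (1 - rho) * EN).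
Proof.
pose c n : R := (rho * n%:R ^+ 2 + (1 - rho) * n%:R) * m2.
have [ic Ec] : P.-integrable setT (fun w => (c (N w))%:E) /\
    \int[P]_w c (N w) = m2 * (rho * EN2 + (1 - rho) * EN).
  have cE w : c (N w) = 0 * (N w)%:R ^+ 3 + m2 * rho * (N w)%:R ^+ 2 + m2 * (1 - rho) * (N w)%:R.
    by rewrite /c; ring.
  have [i E] := Rintegral_nat_comb 0 (m2 * rho) (m2 * (1 - rho)).
  split; first by move: i; apply: eq_integrable => // w _; rewrite cE.
  by under eq_Rintegral do rewrite cE; rewrite E; ring.
have [||//|iY EY] := at_index (J := iota 0) (c := c) indepN measurable_familyX
  (exprn_measurable 2).
- by move=> n; have [] := second_moment_sumRV n.
- move=> n; under eq_Rintegral do rewrite ger0_norm ?sqr_ge0//.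
  by have [_ ->] := second_moment_sumRV n.
split; first by move: iY; apply: eq_integrable => // w _; rewrite /= YE.
under eq_Rintegral do rewrite YE.
rewrite [LHS]EY -Ec; apply: eq_Rintegral => w _.
by have [_] := second_moment_sumRV (N w).
Qed.

Let EN_ge0 : 0 <= EN. Proof. by apply: Rintegral_ge0. Qed.

(** Size bias for functions of an integer: they are extended to the half-line by
    rounding down. Applied to the absolute value of a, the identity also yields
    integrability. *)
Lemma integrable_size_biased (a : nat -> R) :
  P.-integrable setT (fun w => ((N w)%:R * a (N w))%:E) ->
  P.-integrable setT (fun w => (a (Ns w))%:E) /\
  \int[P]_w a (Ns w) = \int[P]_w ((N w)%:R * a (N w)) / EN.
Proof.
have floor_measurable (b : nat -> R) :
    measurable_fun (`[0, +oo[%classic : set R) (fun x => b (Num.truncn x)).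
  move=> _ B mB.
  rewrite (_ : _ `&` _ = \bigcup_(n in [set n | B (b n)]) `[n%:R, n.+1%:R[%classic).
    by apply: bigcup_measurable => n _; exact: measurable_itv.
  apply/seteqP; split => x /=.
    rewrite in_itv/= andbT => -[x0 Bx]; exists (Num.truncn x) => //=.
    by rewrite in_itv/= truncn_itv.
  move=> [n /= Bn]; rewrite !in_itv/= andbT => /andP[nx xn].
  have x0 : 0 <= x by rewrite (le_trans _ nx).
  split => //; suff -> : Num.truncn x = n by [].
  by apply/eqP; rewrite truncn_eq// nx.
have law (b : nat -> R) : P.-integrable setT (fun w => ((N w)%:R * b (N w))%:E) ->
    (\int[P]_w (b (Ns w))%:E = (\int[P]_w ((N w)%:R * b (N w)) / EN)%:E)%E.
  move=> ib; have bK n : b (Num.truncn (n%:R : R)) = b n by rewrite natrK.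
  have := biased (floor_measurable b).
  rewrite (_ : (fun w => ((N w)%:R * b (Num.truncn (N w)%:R))%:E) =
    (fun w => ((N w)%:R * b (N w))%:E)); last by apply/funext => w; rewrite bK.
  move=> /(_ ib); rewrite unlock.
  under eq_integral do rewrite /= bK.
  move=> ->; under eq_integral do rewrite bK.
  by rewrite EFinM /Rintegral fineK// integrable_fin_num.
move=> ia; have la := law _ ia.
have ian : P.-integrable setT (fun w => ((N w)%:R * `|a (N w)|)%:E).
  have := integrable_norm ia; apply: eq_integrable => // w _.
  by rewrite /= normrM normr_nat.
split; last by rewrite /Rintegral la.
apply/integrableP; split.
  by apply/measurable_EFinP; exact: (measurableT_comp (f := a)).
by under eq_integral do rewrite abse_EFin; rewrite (law (fun n => `|a n|) ian) ltry.
Qed.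

Variables (f g : R -> R) (s : R).
Hypotheses (s0 : 0 <= s) (df : forall z, is_derive z (1 : R) f (g z)).
Hypotheses (gL : forall u v, `|g v - g u| <= 2 * `|v - u|) (f1 : forall z, `|f z| <= 1).

Let mf := measurable_stein_f df.
Let mg := measurable_stein_g gL.

Let mgs : measurable_fun setT (fun x => g (s * x)).
Proof. by apply: measurableT_comp => //; apply: measurable_funM. Qed.

Let a (x : R) := x * f (s * x).

Let ma : measurable_fun setT a.
Proof.
apply: measurable_funM => //.
by apply: measurableT_comp => //; apply: measurable_funM.
Qed.

Let a_le x : `|a x| <= `|x|.
Proof. by rewrite normrM ler_piMr. Qed.

(** The mean of g at a sum of n independent copies, as a function of n; it will
    be evaluated at N - 1 with weight N, hence at N^s - 1. *)
Let e n := \int[P]_w g (s * sumRV X' (iota 0 n) w).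

(** The two regimes of the mixture: n equal summands with weight rho, n
    independent summands with weight 1 - rho. *)
Lemma stein_error_sum n :
  P.-integrable setT (EFin \o (a \o sumRV X (iota 0 n))) /\
  `|\int[P]_w a (sumRV X (iota 0 n) w) -
    s * m2 * (rho * (n%:R ^+ 2 * g 0) + (1 - rho) * (n%:R * e n.-1))| <=
  s ^+ 2 * m3 * (rho * n%:R ^+ 3 + (1 - rho) * n%:R).
Proof.
have [iV EV] := stein_error_multiple iX3 X0mean s0 df gL (ler0n R n).
have := stein_error_iid_sum iX3 X0mean iidX' s0 df gL f1 (iota_uniq 0 n).
rewrite size_iota -/(e n.-1) => -[iW EW].
have aV w : a (sumRV (fun=> X 0%N) (iota 0 n) w) = n%:R * X 0%N w * f (s * (n%:R * X 0%N w)).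
  by rewrite /a constant_sum.
have iV' : P.-integrable setT (EFin \o (a \o sumRV (fun=> X 0%N) (iota 0 n))).
  by move: iV; apply: eq_integrable => // w _; rewrite /= aV.
have EV' : \int[P]_w a (sumRV (fun=> X 0%N) (iota 0 n) w) =
    \int[P]_w (n%:R * X 0%N w * f (s * (n%:R * X 0%N w))).
  by apply: eq_Rintegral => w _; exact: aV.
have [iU EU] := integral_law_mixture rho01 (law_sum n) ma iV' iW.
split => //; rewrite [X in `|X - _|]EU [X in rho * X]EV'.
move: EV EW; rewrite -/m2 -/m3.
set A := Rintegral _ _ _; set B := Rintegral _ _ _ => EA EB.
rewrite (_ : _ - _ = rho * (A - s * m2 * (n%:R ^+ 2 * g 0)) +
  (1 - rho) * (B - s * m2 * (n%:R * e n.-1))); last by ring.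
have /andP[r0 r1] := rho01; have r1' : 0 <= 1 - rho by rewrite subr_ge0.
rewrite (le_trans (ler_normD _ _))// !normrM (ger0_norm r0) (ger0_norm r1').
rewrite mulrDr [leRHS](_ : _ = rho * (s ^+ 2 * m3 * n%:R ^+ 3) +
  (1 - rho) * (s ^+ 2 * m3 * n%:R)); last by ring.
by rewrite lerD// ler_wpM2l.
Qed.

Let g_sum_le n : \int[P]_w `|g (s * sumRV X' (iota 0 n) w)| <= `|g 0| + 2 * s * m1 * n%:R ^+ 1.
Proof.
have iS := integrable_sumRV (iota 0 n) iX'k.
have ig := integrable_stein_g s0 gL iS.
have i1 : P.-integrable setT (EFin \o cst `|g 0|) by exact: finite_measure_integrable_cst.
have i2 := integrableZl measurableT (2 * s) (integrable_norm iS).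
apply: (@le_trans _ _ (\int[P]_w (`|g 0| + 2 * s * `|sumRV X' (iota 0 n) w|))).
  apply: le_Rintegral => //; first exact: (integrable_norm ig).
    by have := integrableD measurableT i1 i2; apply: eq_integrable.
  move=> w _; rewrite (le_trans (stein_g_growth gL _))// lerD2l normrM (ger0_norm s0).
  by rewrite mulrA.
rewrite RintegralD// Rintegral_prob_cst lerD2l RintegralZl//; last exact: (integrable_norm iS).
rewrite expr1 -[leRHS]mulrA ler_wpM2l ?mulr_ge0// mulrC.
by have := abs_sum_le (iota 0 n) iX'k iidX'.2; rewrite size_iota.
Qed.

Let e_le n : `|e n| <= `|g 0| + 2 * s * m1 * n%:R ^+ 1.
Proof.
have ig := integrable_stein_g s0 gL (integrable_sumRV (iota 0 n) iX'k).
exact: (le_trans (le_normr_Rintegral measurableT ig) (g_sum_le n)).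
Qed.

Let Y' w := sumRV X' (iota 0 (Ns w).-1) w.

Let iNs : P.-integrable setT (fun w => ((Ns w)%:R : R)%:E).
Proof.
apply: (integrable_size_biased (a := fun n => n%:R) _).1.
by move: iN2; apply: eq_integrable => // w _; rewrite expr2.
Qed.

Let predn_le n : (n.-1)%:R <= n%:R :> R.
Proof. by rewrite ler_nat leq_pred. Qed.

Lemma integrable_biased_sum : P.-integrable setT (EFin \o Y').
Proof.
have [|||//] := at_index (J := fun n => iota 0 n.-1) (c := fun n => n%:R * m1) indepNs
  measurable_familyX' mid.
- by move=> n; exact: integrable_sumRV.
- move=> n; apply: (le_trans (abs_sum_le (iota 0 n.-1) iX'k iidX'.2)).
  by rewrite size_iota ler_wpM2r.
- by have := integrableZr measurableT m1 iNs; apply: eq_integrable.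
Qed.

Let iNe : P.-integrable setT (fun w => ((N w)%:R * e (N w).-1)%:E).
Proof.
apply: (integrable_nat_pow_le (c := fun n => n%:R * e n.-1) (a := `|g 0|)
  (b := `|g 0| + 2 * s * m1) iN2) => -[|n].
  by rewrite mul0r normr0 addr_ge0// mulr_ge0 ?addr_ge0// ?mulr_ge0// ?sqr_ge0.
rewrite normrM normr_nat /=.
have : n.+1%:R * `|e n| <= n.+1%:R * (`|g 0| + 2 * s * m1 * n%:R).
  by rewrite ler_wpM2l.
have : 2 * s * m1 * (n.+1%:R * n%:R) <= 2 * s * m1 * n.+1%:R ^+ 2.
  by rewrite ler_wpM2l ?mulr_ge0// expr2 ler_wpM2l// ler_nat.
have : `|g 0| * n.+1%:R <= `|g 0| * n.+1%:R ^+ 2.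
  by rewrite ler_wpM2l// expr2 ler_peMr// ler1n.
have := normr_ge0 (g 0); set G := `|g 0|; set E := `|e n|; set N1 := n.+1%:R.
set N0 := n%:R; set q := 2 * s * m1.
by rewrite !mulrDr !mulrDl mulrA [N1 * G]mulrC (mulrCA N1 q); lra.
Qed.

(** The weight N in front of e (N - 1) is what size biasing absorbs. *)
Lemma Rintegral_stein_biased_sum :
  P.-integrable setT (EFin \o (fun w => g (s * Y' w))) /\
  \int[P]_w g (s * Y' w) = \int[P]_w ((N w)%:R * e (N w).-1) / EN.
Proof.
have [|||iY EY] := at_index (J := fun n => iota 0 n.-1)
  (c := fun n => `|g 0| + 2 * s * m1 * n%:R) indepNs measurable_familyX' mgs.
- by move=> n; exact: (integrable_stein_g s0 gL (integrable_sumRV _ iX'k)).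
- move=> n; apply: (le_trans (g_sum_le _)); rewrite lerD2l ler_wpM2l ?mulr_ge0//.
  by rewrite expr1.
- have i1 : P.-integrable setT (EFin \o cst `|g 0|) by exact: finite_measure_integrable_cst.
  have := integrableD measurableT i1 (integrableZl measurableT (2 * s * m1) iNs).
  by apply: eq_integrable.
split; first by move: iY; apply: eq_integrable.
rewrite [LHS]EY.
by have [_ <-] := integrable_size_biased (a := fun n => e n.-1) iNe.
Qed.

Let iY := integrable_random_sum.1.

(** The errors for fixed n are averaged over N. The main terms are g 0 with the
    weight rho E[N^2] of equal summands and, after size biasing, the mean of
    g at a sum of N^s - 1 independent copies with the weight (1 - rho) E[N]. *)
Lemma stein_error_random_sum : 0 < EN ->
  P.-integrable setT (EFin \o (fun w => Y w * f (s * Y w))) /\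
  `|\int[P]_w (Y w * f (s * Y w)) -
    s * m2 * (rho * EN2 * g 0 + (1 - rho) * EN * \int[P]_w g (s * Y' w))| <=
  s ^+ 2 * m3 * (rho * EN3 + (1 - rho) * EN).
Proof.
move=> EN0.
have [|||iaY EaY] := at_index (J := iota 0) (c := fun n => n%:R * m1) indepN
  measurable_familyX ma.
- by move=> n; have [] := stein_error_sum n.
- move=> n; have := abs_sum_le (iota 0 n) iXk lawX; rewrite size_iota.
  apply: le_trans; apply: le_Rintegral => //.
  + by have [i _] := stein_error_sum n; exact: (integrable_norm i).
  + exact: (integrable_norm (integrable_sumRV _ iXk)).
- by have := integrableZr measurableT m1 iN1; apply: eq_integrable.
split; first by move: iaY; apply: eq_integrable => // w _; rewrite /= YE.
under eq_Rintegral do rewrite YE.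
rewrite [X in `|X - _|]EaY.
pose v n := s * m2 * (rho * (n%:R ^+ 2 * g 0) + (1 - rho) * (n%:R * e n.-1)).
pose er n := 0 + s ^+ 2 * m3 * (rho * n%:R ^+ 3 + (1 - rho) * n%:R) : R.
have i1 : P.-integrable setT (EFin \o (fun w => s * m2 * rho * g 0 * (N w)%:R ^+ 2)).
  by have := integrableZl measurableT (s * m2 * rho * g 0) iN2; apply: eq_integrable.
have i2 : P.-integrable setT (EFin \o (fun w => s * m2 * (1 - rho) * ((N w)%:R * e (N w).-1))).
  by have := integrableZl measurableT (s * m2 * (1 - rho)) iNe; apply: eq_integrable.
have vE w : v (N w) = s * m2 * rho * g 0 * (N w)%:R ^+ 2 +
    s * m2 * (1 - rho) * ((N w)%:R * e (N w).-1) by rewrite /v; ring.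
have iv : P.-integrable setT (EFin \o (fun w => v (N w))).
  by have := integrableD measurableT i1 i2; apply: eq_integrable => // w _; rewrite /= vE.
have Ev : \int[P]_w v (N w) =
    s * m2 * (rho * EN2 * g 0 + (1 - rho) * EN * \int[P]_w g (s * Y' w)).
  under eq_Rintegral do rewrite vE.
  rewrite RintegralD// !RintegralZl// Rintegral_stein_biased_sum.2 -/EN2.
  by field; rewrite gt_eqF.
have erE w : er (N w) = s ^+ 2 * m3 * rho * (N w)%:R ^+ 3 + 0 * (N w)%:R ^+ 2 +
    s ^+ 2 * m3 * (1 - rho) * (N w)%:R by rewrite /er; ring.
have [i3 E3] := Rintegral_nat_comb (s ^+ 2 * m3 * rho) 0 (s ^+ 2 * m3 * (1 - rho)).
have ier : P.-integrable setT (EFin \o (fun w => er (N w))).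
  by move: i3; apply: eq_integrable => // w _; rewrite /= erE.
have Eer : \int[P]_w er (N w) = s ^+ 2 * m3 * (rho * EN3 + (1 - rho) * EN).
  by under eq_Rintegral do rewrite erE; rewrite E3; ring.
have [||_] := Rintegral_error_le (u := fun w => \int[P]_v a (sumRV X (iota 0 (N w)) v)) _ iv ier.
- exact: (measurableT_comp (f := fun n => \int[P]_v a (sumRV X (iota 0 n) v))).
- by move=> w; rewrite /er add0r; have [_] := stein_error_sum (N w).
by rewrite Ev Eer.
Qed.

Let iY2 := second_moment_random_sum.1.

Let sigma2 := m2 * (rho * EN2 + (1 - rho) * EN).
Hypothesis s_standard : s ^+ 2 * sigma2 = 1.

Let iYs : P.-integrable setT (EFin \o (fun w => s * Y w)).
Proof. by have := integrableZl measurableT s iY; apply: eq_integrable. Qed.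

(** From 2 |x| <= 1 + x^2, the second moment being 1. *)
Let abs_standardized_le1 : \int[P]_w `|s * Y w| <= 1.
Proof.
have i1 : P.-integrable setT (EFin \o cst (2^-1 : R)) by exact: finite_measure_integrable_cst.
have i2 : P.-integrable setT (EFin \o (fun w => s ^+ 2 / 2 * Y w ^+ 2)).
  by have := integrableZl measurableT (s ^+ 2 / 2) iY2; apply: eq_integrable.
apply: (@le_trans _ _ (\int[P]_w (2^-1 + s ^+ 2 / 2 * Y w ^+ 2))).
  apply: le_Rintegral => //; first exact: (integrable_norm iYs).
    by have := integrableD measurableT i1 i2; apply: eq_integrable.
  move=> w _; have := sqr_ge0 (`|s * Y w| - 1).
  rewrite sqrrB mulr1 expr1n real_normK ?num_real// exprMn; lra.
rewrite RintegralD// Rintegral_prob_cst RintegralZl// second_moment_random_sum.2 -/sigma2.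
by have := s_standard; lra.
Qed.

(** Multiplied by s, the weights of the two main terms of
    [stein_error_random_sum] become tau and 1 - tau. The mean of g at s Y is
    split with the same weights and each share is compared with its main term
    by the Lipschitz bound on g: the distance is |s Y|, of mean at most 1, for
    the first one and s |Y' - Y| for the second one. *)
Lemma stein_operator_bound : 0 < EN ->
  `|\int[P]_w (g (s * Y w) - s * Y w * f (s * Y w))| <=
  2 * (s ^+ 2 * m2 * (rho * EN2)) +
  2 * (s ^+ 2 * m2 * ((1 - rho) * EN)) * s * \int[P]_w `|Y' w - Y w| +
  s ^+ 3 * m3 * (rho * EN3 + (1 - rho) * EN).
Proof.
move=> EN0; have [iSt ESt] := stein_error_random_sum EN0.
have mgY : measurable_fun setT (fun w => g (s * Y w)).
  by apply: (measurableT_comp mg); apply/measurable_EFinP; exact: (measurable_int P iYs).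
have igY : P.-integrable setT (EFin \o (fun w => g (s * Y w))).
  have i1 : P.-integrable setT (EFin \o cst `|g 0|) by exact: finite_measure_integrable_cst.
  have i2 := integrableZl measurableT 2 (integrable_norm iYs).
  have := integrableD measurableT i1 i2; apply: le_integrable => //.
    exact/measurable_EFinP.
  move=> w _ /=; rewrite lee_fin [leRHS]ger0_norm; last by rewrite addr_ge0// mulr_ge0.
  exact: (stein_g_growth gL).
have [igY' _] := Rintegral_stein_biased_sum.
have iD : P.-integrable setT (EFin \o (fun w => Y' w - Y w)).
  by have := integrableB measurableT integrable_biased_sum iY; apply: eq_integrable.
have iDn := integrable_norm iD.
pose tau := s ^+ 2 * m2 * (rho * EN2); pose sig := s ^+ 2 * m2 * ((1 - rho) * EN).
have /andP[r0 r1] := rho01; have r1' : 0 <= 1 - rho by rewrite subr_ge0.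
have m2_0 : 0 <= m2 by apply: Rintegral_ge0 => w _; exact: sqr_ge0.
have EN2_0 : 0 <= EN2 by apply: Rintegral_ge0 => w _; exact: sqr_ge0.
have tau0 : 0 <= tau by rewrite !mulr_ge0// exprn_ge0.
have sig0 : 0 <= sig by rewrite !mulr_ge0// exprn_ge0.
(* The standardization of Y, read in terms of the weights. *)
have tausig : tau + sig = 1 by rewrite -s_standard /tau /sig /sigma2; ring.
have Etau : `|\int[P]_w g (s * Y w) - g 0| <= 2.
  have iv : P.-integrable setT (EFin \o cst (g 0)) by exact: finite_measure_integrable_cst.
  have ie : P.-integrable setT (EFin \o (fun w => 2 * `|s * Y w|)).
    by have := integrableZl measurableT 2 (integrable_norm iYs); apply: eq_integrable.
  have [||_] := Rintegral_error_le (u := fun w => g (s * Y w)) _ iv ie.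
  - exact: mgY.
  - by move=> w; have := gL 0 (s * Y w); rewrite subr0.
  rewrite Rintegral_prob_cst RintegralZl//; last exact: (integrable_norm iYs).
  by move=> /le_trans; apply; have := abs_standardized_le1; lra.
have Esig : `|\int[P]_w g (s * Y w) - \int[P]_w g (s * Y' w)| <=
    2 * s * \int[P]_w `|Y' w - Y w|.
  have ie : P.-integrable setT (EFin \o (fun w => 2 * s * `|Y' w - Y w|)).
    by have := integrableZl measurableT (2 * s) iDn; apply: eq_integrable.
  have [||_] := Rintegral_error_le (u := fun w => g (s * Y w)) _ igY' ie.
  - exact: mgY.
  - move=> w; rewrite (le_trans (gL _ _))// -mulrBr normrM (ger0_norm s0) distrC.
    by rewrite mulrA.
  by rewrite RintegralZl.
rewrite RintegralB//; last first.
  have := integrableZl measurableT s iSt; apply: eq_integrable => // w _ /=.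
  by rewrite -EFinM mulrA.
rewrite (_ : \int[P]_w (s * Y w * f (s * Y w)) = s * \int[P]_w (Y w * f (s * Y w))); last first.
  by rewrite -RintegralZl//; apply: eq_Rintegral => w _; rewrite mulrA.
move: Etau Esig ESt; set A := \int[P]_w g (s * Y w); set B := \int[P]_w g (s * Y' w).
set D := Rintegral _ _ _; set C := Rintegral _ _ _ => Etau Esig ESt.
pose F := C - s * m2 * (rho * EN2 * g 0 + (1 - rho) * EN * B).
have -> : A - s * C = tau * (A - g 0) + sig * (A - B) - s * F.
  rewrite -[X in X - _]mul1r -tausig /F /tau /sig; ring.
have H1 : `|tau * (A - g 0)| <= tau * 2 by rewrite normrM (ger0_norm tau0) ler_wpM2l.
have H2 : `|sig * (A - B)| <= sig * (2 * s * D) by rewrite normrM (ger0_norm sig0) ler_wpM2l.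
have H3 : `|s * F| <= s * (s ^+ 2 * m3 * (rho * EN3 + (1 - rho) * EN)).
  by rewrite normrM (ger0_norm s0) ler_wpM2l.
apply: (le_trans (ler_normB _ _)); apply: lerD; last first.
  by apply: (le_trans H3); rewrite -[s ^+ 3]/(s * s ^+ 2) !mulrA.
apply: (le_trans (ler_normD _ _)); apply: lerD; first by apply: (le_trans H1); rewrite [leLHS]mulrC.
by apply: (le_trans H2); rewrite [leLHS](_ : _ = 2 * sig * s * D)//; ring.
Qed.

End random_sums.

(** * Expectation, variance and the normal law *)

Lemma expectation_Rintegral d (T : measurableType d) (R : realType) (P : probability T R)
    (U : T -> R) : P.-integrable setT (EFin \o U) -> ('E_P[U] = (\int[P]_w U w)%:E)%E.
Proof. by move=> iU; rewrite unlock /Rintegral fineK// integrable_fin_num. Qed.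

(** The mean is required to vanish as an extended real number, since a variance
    subtracts its finite part. *)
Lemma variance_centered d (T : measurableType d) (R : realType) (P : probability T R)
    (U : T -> R) : ('E_P[U] = 0)%E -> P.-integrable setT (EFin \o (fun w => U w ^+ 2)) ->
  ('V_P[U] = (\int[P]_w (U w ^+ 2))%:E)%E.
Proof.
move=> U0 iU2; rewrite -expectation_Rintegral// /variance covariance.unlock U0 /=.
by congr ('E_P[_])%E; apply/funext => w; rewrite /= !fctE /= !subr0 expr2.
Qed.

Lemma integrable_expectation_lty d (T : measurableType d) (R : realType) (P : probability T R)
    (U : T -> R) : measurable_fun setT U -> (forall w, 0 <= U w) -> ('E_P[U] < +oo)%E ->
  P.-integrable setT (EFin \o U).
Proof.
rewrite unlock => mU U0 Uoo; apply/integrableP; split; first exact/measurable_EFinP.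
by under eq_integral do rewrite /= ger0_norm//.
Qed.

(** A law given by a density integrates Lipschitz functions through it. *)
Lemma integral_normal_law d (T : measurableType d) (R : realType) (P : probability T R)
    (Z : {RV P >-> R}) (h : R -> R) :
  (forall A : set R, measurable A -> distribution P Z A = normal_prob 0 1 A) ->
  (forall x y, `|h y - h x| <= `|y - x|) ->
  P.-integrable setT (EFin \o (h \o Z)) /\
  \int[P]_w h (Z w) = \int[lebesgue_measure]_x (h x * normal_pdf 0 1 x).
Proof.
move=> lawZ hL.
have mh : measurable_fun setT h.
  by apply: continuous_measurable_fun; exact: lipschitz1_continuous.
(* Lebesgue measure is carried by the sigma-algebra generated by the half-open
   intervals, which is the Borel one under another name: Z is read with values
   in that space. *)
have mZ : measurable_fun setT (Z : T -> measurableTypeR R).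
  by move=> _ A mA; rewrite setTI; apply: measurable_funPTI.
pose Z' : {RV P >-> measurableTypeR R} :=
  @mfun_Sub _ _ T (measurableTypeR R) Z (mem_set mZ).
have [||iZ EZ] := @integral_density _ _ R lebesgue_measure (distribution P Z')
  (normal_pdf 0 1) (measurable_normal_pdf 0 1) _ _ h mh (integrable_lipschitz_normal_pdf hL).
- by move=> x; exact: normal_pdf_ge0.
- by move=> A mA; exact: lawZ.
have iPZ := integrable_of_distribution iZ.
split => //; rewrite /Rintegral -EZ integral_distribution//.
exact/measurable_EFinP.
Qed.

(** * The Wasserstein bound *)

(** Here q is the standard deviation of the random sum, rho EN2 / D is the
    weight tau of equal summands, and (1 - rho) EN / D is 1 - tau. *)
Lemma standardized_stein_bound (R : realType) (rho EN EN2 EN3 m2 m3 D q W : R) :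
  D = rho * EN2 + (1 - rho) * EN -> q ^+ 2 = m2 * D ->
  D != 0 -> EN2 != 0 -> m2 != 0 -> q != 0 ->
  2 * (q^-1 ^+ 2 * m2 * (rho * EN2)) + 2 * (q^-1 ^+ 2 * m2 * ((1 - rho) * EN)) * q^-1 * W +
    q^-1 ^+ 3 * m3 * (rho * EN3 + (1 - rho) * EN) =
  2 * (rho * EN2 / D) * (1 + EN3 * m3 / (2 * EN2 * m2 * q)) +
    2 * (1 - rho * EN2 / D) / q * (m3 / (2 * m2) + W).
Proof.
move=> DE q2 D0 EN2_0 m2_0 q0.
have -> : 1 - rho * EN2 / D = (1 - rho) * EN / D.
  by apply: (mulIf D0); rewrite mulrBl !divfK// mul1r DE; ring.
have sq : q^-1 ^+ 2 = (m2 * D)^-1 by rewrite exprVn q2.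
rewrite -[q^-1 ^+ 3]/(q^-1 * q^-1 ^+ 2) sq.
by field; rewrite q0 D0 m2_0 EN2_0.
Qed.

Theorem theorem2p2 (R : realType) (d : measure_display) (T : measurableType d)
  (P : probability T R)
  (N : {RV P >-> nat}) (X : nat -> {RV P >-> R}) (rho : R)
  (hN1 : (0 < 'E_P[fun w => ((N w)%:R)%R])%E)
  (hN3 : ('E_P[fun w => ((N w)%:R ^+ 3)%R] < +oo)%E)
  (hXexch : exchangeable P (fun k => X k : T -> R))
  (hXN : independent_systems P (g_sigma_algebra_preimage N)
           (sigma_family (fun k => X k : T -> R)))
  (hX1 : ('E_P[X 0%N] = 0)%E)
  (hX2 : (0 < 'V_P[X 0%N])%E)
  (hX3 : ('E_P[fun w => (`|X 0%N w| ^+ 3)%R] < +oo)%E)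
  (hrho : 0 <= rho <= 1)
  (hcorr : equally_correlated P (fun k => X k : T -> R) rho)
  (dZ : measure_display) (TZ : measurableType dZ) (PZ : probability TZ R)
  (Z : {RV PZ >-> R})
  (hZ : forall A : set R, measurable A ->
          distribution PZ Z A = normal_prob 0 1 A)
  (Ns : {RV P >-> nat}) (X' : nat -> {RV P >-> R})
  (hNs : size_biased P (fun w => (N w)%:R) (fun w => (Ns w)%:R))
  (hX' : iid_copies P (fun j => X' j : T -> R) (X 0%N))
  (hindep : independent_systems P
     (g_sigma_algebra_preimage (fun w => (N w, Ns w)))
     (sigma_family (fun i : nat + nat =>
        match i with inl k => X k : T -> R | inr j => X' j : T -> R end))) :
  let EN := fine ('E_P[fun w => ((N w)%:R)%R])%E in
  let EN2 := fine ('E_P[fun w => ((N w)%:R ^+ 2)%R])%E in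
  let EN3 := fine ('E_P[fun w => ((N w)%:R ^+ 3)%R])%E in
  let ENN1 := fine ('E_P[fun w => ((N w)%:R * ((N w)%:R - 1))%R])%E in
  let varX := fine ('V_P[X 0%N])%E in
  let EX3 := fine ('E_P[fun w => (`|X 0%N w| ^+ 3)%R])%E in
  let Y := random_sum N (fun k => X k : T -> R) in
  let varY := fine ('V_P[Y])%E in
  let sdY := Num.sqrt varY in
  let tau := rho * EN2 / (EN + rho * ENN1) in
  ('V_P[Y] = (varX * (EN + rho * ENN1))%:E)%E /\
  (wasserstein P PZ (fun w => Y w / sdY)%R Z <=
     (2 * tau * (1 + EN3 * EX3 / (2 * EN2 * varX * sdY)))%:E +
     (2 * (1 - tau) / sdY)%:E *
       ((EX3 / (2 * varX))%:E +
        'E_P[fun w => (`|\sum_(j < (Ns w).-1) X' j w - \sum_(k < N w) X k w|)%R]))%E.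
Proof.
move=> EN EN2 EN3 ENN1 varX EX3 Y varY sdY tau.
have mN (c : nat -> R) : measurable_fun setT (fun w => c (N w)).
  exact: (measurableT_comp (f := c)).
have iN3 : P.-integrable setT (fun w => ((N w)%:R ^+ 3)%:E).
  apply: (integrable_expectation_lty (mN (fun n => n%:R ^+ 3))) => //.
have iX3 : P.-integrable setT (EFin \o ((fun x => `|x| ^+ 3) \o X 0%N)).
  apply: (integrable_expectation_lty (U := fun w => `|X 0%N w| ^+ 3)) => //.
  by apply: measurable_funX; exact: measurableT_comp.
have iX1 := integrable_third_moment1 iX3.
have X0mean : \int[P]_w X 0%N w = 0.
  by move: hX1; rewrite expectation_Rintegral// => -[].
have lawX j := exchangeable_same_law j hXexch.
have iN k (k3 : (k <= 3)%N) := integrable_nat_pow k3 iN3.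
have ENE : EN = \int[P]_w ((N w)%:R) by rewrite /EN expectation_Rintegral//; exact: (iN 1%N isT).
have EN2E : EN2 = \int[P]_w ((N w)%:R ^+ 2) by rewrite /EN2 expectation_Rintegral//; exact: (iN 2%N isT).
have EN3E : EN3 = \int[P]_w ((N w)%:R ^+ 3) by rewrite /EN3 expectation_Rintegral.
have ENN1E : ENN1 = EN2 - EN.
  rewrite /ENN1 (_ : (fun w => _) = (fun w => (N w)%:R ^+ 2 - (N w)%:R)); last first.
    by apply/funext => w; ring.
  rewrite expectation_Rintegral; last first.
    have := integrableB measurableT (iN 2%N isT) (iN 1%N isT).
    by apply: eq_integrable.
  by rewrite /= RintegralB ?EN2E ?ENE//; [exact: (iN 2%N isT) | exact: (iN 1%N isT)].
have varXE : varX = \int[P]_w (X 0%N w ^+ 2).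
  by rewrite /varX variance_centered//; exact: (integrable_third_moment2 iX3).
have EX3E : EX3 = \int[P]_w (`|X 0%N w| ^+ 3) by rewrite /EX3 expectation_Rintegral.
have [iY meanY] := integrable_random_sum iN3 iX3 X0mean lawX hindep.
have [iY2 EY2] := second_moment_random_sum hrho iN3 iX3 X0mean lawX hcorr hX' hindep.
pose D := EN + rho * ENN1.
have DE : D = rho * EN2 + (1 - rho) * EN by rewrite /D ENN1E; ring.
have VY : ('V_P[Y] = (varX * D)%:E)%E.
  rewrite variance_centered//; last by rewrite expectation_Rintegral// meanY.
  by rewrite EY2 -varXE -EN2E -ENE DE.
split => //.
have varX0 : 0 < varX.
  move: hX2; rewrite variance_centered//; last exact: (integrable_third_moment2 iX3).
  by rewrite lte_fin varXE.
have EN0 : 0 < EN.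
  by move: hN1; rewrite expectation_Rintegral ?lte_fin ?ENE//; exact: (iN 1%N isT).
have EN2_ge : EN <= EN2.
  rewrite ENE EN2E; apply: le_Rintegral => //; [exact: (iN 1%N isT) | exact: (iN 2%N isT) |].
  by move=> w _; rewrite -natrX ler_nat; case: (N w) => // n; rewrite expnS leq_pmulr.
have D0 : 0 < D.
  have /andP[r0 r1] := hrho.
  by rewrite /D ltr_pwDl// mulr_ge0// ENN1E subr_ge0.
have varYE : varY = varX * D by rewrite /varY VY.
have sd0 : 0 < sdY by rewrite sqrtr_gt0 varYE mulr_gt0.
have sd2 : sdY ^+ 2 = varX * D by rewrite sqr_sqrtr ?varYE// ltW// mulr_gt0.
have s0 : 0 <= sdY^-1 by rewrite invr_ge0 ltW.
have s_standard : sdY^-1 ^+ 2 * (varX * (rho * EN2 + (1 - rho) * EN)) = 1.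
  by rewrite -DE exprVn sd2 mulVf// gt_eqF// mulr_gt0.
(* The supremum is bounded one test function at a time, each of them through
   the solution of its Stein equation. *)
apply: ge_ereal_sup => _ [h hW <-].
have hL := wasserstein_test_lipschitz hW.
have [f [g [df gE f1 gL]]] := stein_solution hL.
have [iZ EZ] := integral_normal_law hZ hL.
pose D' w := \sum_(j < (Ns w).-1) X' j w - \sum_(k < N w) X k w.
have D'E w : sumRV X' (iota 0 (Ns w).-1) w - Y w = D' w by rewrite sumRV_iota.
have iD' : P.-integrable setT (EFin \o (fun w => `|D' w|)).
  have iY' := integrable_biased_sum iN3 iX3 hX' hindep hNs.
  have := integrable_norm (integrableB measurableT iY' iY).
  by apply: eq_integrable => // w _; rewrite /= -D'E.
rewrite (expectation_Rintegral iD').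
rewrite -(EFinD (EX3 / (2 * varX))) -(EFinM (2 * (1 - tau) / sdY)) -EFinD.
have ihY : P.-integrable setT (EFin \o (fun w => h (Y w / sdY))).
  have iW : P.-integrable setT (EFin \o (fun w => Y w / sdY)).
    have := integrableZl measurableT sdY^-1 iY.
    by apply: eq_integrable => // w _; rewrite /= mulrC.
  have i1 : P.-integrable setT (EFin \o cst `|h 0|) by exact: finite_measure_integrable_cst.
  have := integrableD measurableT i1 (integrable_norm iW); apply: le_integrable => //.
    apply/measurable_EFinP; apply: (measurableT_comp (f := h)).
      by apply: continuous_measurable_fun; exact: lipschitz1_continuous.
    by apply/measurable_EFinP; exact: (measurable_int P iW).
  move=> w _ /=; rewrite lee_fin [leRHS]ger0_norm ?addr_ge0//.
  have := ler_normD (h (Y w / sdY) - h 0) (h 0); rewrite subrK => /le_trans; apply.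
  by rewrite [leRHS]addrC lerD2r (le_trans (hL 0 _))// subr0.
rewrite (expectation_Rintegral (U := h \o (fun w => Y w / sdY)) ihY) (expectation_Rintegral iZ).
rewrite -EFinB abse_EFin lee_fin.
rewrite -(standardized_stein_bound EN3 EX3 _ DE sd2); last 4 first.
- by rewrite gt_eqF.
- by rewrite gt_eqF// (lt_le_trans EN0).
- by rewrite gt_eqF.
- by rewrite gt_eqF.
have bound := stein_operator_bound hrho iN3 iX3 X0mean lawX hcorr hX' hindep hNs s0 df gL f1.
move: bound; rewrite -ENE -EN2E -EN3E -varXE -EX3E => /(_ s_standard EN0).
have -> : \int[P]_w `|sumRV X' (iota 0 (Ns w).-1) w - Y w| = \int[P]_w `|D' w|.
  by apply: eq_Rintegral => w _; rewrite D'E.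
apply: le_trans; rewrite /= EZ le_eqVlt; apply/orP; left; apply/eqP; congr (`|_|).
pose c := \int[lebesgue_measure]_x (h x * normal_pdf 0 1 x).
have ic : P.-integrable setT (EFin \o cst c) by exact: finite_measure_integrable_cst.
rewrite -[X in _ - X](Rintegral_prob_cst P c) -RintegralB//.
by apply: eq_Rintegral => w _; rewrite gE addrAC subrr add0r [sdY^-1 * _]mulrC.
Qed.
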